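(* Let $t$ be a $2n$-tangle ($n\ge 1$), represented by a diagram, and let $\mathcal{I}_t$ be the ideal of $\mathbb{Z}[A^{\pm1}]$ generated by the Kauffman bracket polynomials $\langle t^c\rangle$, where $c$ ranges over all Catalan $2n$-tangles. If $t$ embeds in a link $\ell$, then $\langle\ell\rangle\in\mathcal{I}_t$.
   Context: A $2n$-tangle consists of $n$ disjoint arcs and finitely many simple closed curves properly embedded in the $3$-ball, represented by diagrams up to Reidemeister moves. It embeds in a link $\ell$ if some diagram for $t$ extends to a diagram for $\ell$. For $2n$-tangles $t,s$, $t^s$ denotes the link (diagram) obtained by joining the corresponding ends of $t$ and $s$ without introducing crossings. A Catalan tangle is a $2n$-tangle diagram without crossings or trivial (closed) components; there are $\frac{1}{n+1}\binom{2n}{n}$ of them. The Kauffman bracket $\langle\cdot\rangle\in\mathbb{Z}[A^{\pm1}]$ of a framed link (diagram) is determined by $\langle\ell_+\rangle=A\langle\ell_0\rangle+A^{-1}\langle\ell_\infty\rangle$, where $\ell_0,\ell_\infty$ are the $A$- and $B$-smoothings of a crossing of $\ell_+$, by $\langle\ell\cup\bigcirc\rangle=(-A^2-A^{-2})\langle\ell\rangle$, and by the value $1$ on the crossingless unknot. Changing the diagram or framing of a link changes the bracket only by units $\pm A^{k}$ of $\mathbb{Z}[A^{\pm 1}]$, so membership in an ideal and the ideal itself are not affected. *)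

(* Defs.v *)
From HB Require Import structures.
From Stdlib Require Import Relations.
From mathcomp Require Import all_boot all_algebra fraction boolp zify.

Set Implicit Arguments.
Unset Strict Implicit.
Unset Printing Implicit Defensive.

Import GRing.Theory.
Local Open Scope ring_scope.

Local Notation "x %:F" := (@FracField.tofrac _ x).

(** * The ring Z[A, A^-1], as the subring of Q(A) of fractions p / A^k *)

Definition laurent_pred : pred {fraction {poly int}} :=
  fun x => `[< exists (p : {poly int}) (k : nat), x = p%:F / 'X%:F ^+ k >].

Lemma fracX_neq0 : 'X%:F != 0 :> {fraction {poly int}}.
Proof. by rewrite tofrac_eq0 polyX_eq0. Qed.

Fact laurent_subring : subring_closed laurent_pred.
Proof.
split.
- by apply/asboolP; exists 1, 0%N; rewrite rmorph1 expr0 divr1.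
- move=> _ _ /asboolP[p [k ->]] /asboolP[q [m ->]]; apply/asboolP.
  exists (p * 'X^m - q * 'X^k), (k + m)%N.
  have Xn j : 'X%:F ^+ j != 0 :> {fraction {poly int}}.
    by rewrite expf_neq0 // fracX_neq0.
  rewrite -mulNr addf_div ?Xn // exprD rmorphB !rmorphM !rmorphXn /=.
  by rewrite mulNr.
- move=> _ _ /asboolP[p [k ->]] /asboolP[q [m ->]]; apply/asboolP.
  exists (p * q), (k + m)%N.
  by rewrite mulf_div exprD rmorphM.
Qed.

HB.instance Definition _ :=
  GRing.isSubringClosed.Build {fraction {poly int}} laurent_pred laurent_subring.

Record laurent := Laurent {
  laurent_val : {fraction {poly int}};
  laurentP : laurent_val \in laurent_pred }.

HB.instance Definition _ := [isSub for laurent_val].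
HB.instance Definition _ := [Choice of laurent by <:].
HB.instance Definition _ := [SubChoice_isSubComNzRing of laurent by <:].

Fact A_subproof : 'X%:F \in laurent_pred.
Proof. by apply/asboolP; exists 'X, 0%N; rewrite expr0 divr1. Qed.

Fact Ainv_subproof : ('X%:F)^-1 \in laurent_pred.
Proof. by apply/asboolP; exists 1, 1%N; rewrite rmorph1 div1r expr1. Qed.

Definition A : laurent := Laurent A_subproof.
Definition Ainv : laurent := Laurent Ainv_subproof.

Lemma mulAAinv : A * Ainv = 1.
Proof. by apply: val_inj; rewrite /= divff // fracX_neq0. Qed.

Definition delta : laurent := - A ^+ 2 - Ainv ^+ 2.

(** The ideal generated by a (possibly infinite) set S. *)
Definition ideal_generated (R : comNzRingType) (S : R -> Prop) (x : R) : Prop :=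
  exists2 s : seq (R * R),
    (forall p, p \in s -> S p.2) & x = \sum_(p <- s) p.1 * p.2.

(** * Diagrams

  Planar diagrams of unoriented tangles are written as sliced diagrams, read
  from bottom to top: each slice contains a single local maximum, local minimum
  or crossing, with i vertical strands to its left.
  - [Cup i] creates two neighbouring strands (a local minimum);
  - [Cap i] joins strands i and i+1 (a local maximum);
  - [Cross b i] crosses strands i and i+1; the overstrand is the one running
    from bottom left to top right if b = true, and the one running from bottom
    right to top left if b = false. *)

Inductive slice : Type :=
  | Cup of nat
  | Cap of nat
  | Cross of bool & nat.

Definition diagram := seq slice.

Definition position (s : slice) : nat :=
  match s with Cup i | Cap i | Cross _ i => i end.

(** Numbers of ends of the nontrivial part of a slice, below and above. *)
Definition ends_below (s : slice) : nat := if s is Cup _ then 0%N else 2%N.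
Definition ends_above (s : slice) : nat := if s is Cap _ then 0%N else 2%N.

Definition slice_top (m : nat) (s : slice) : option nat :=
  if (position s + ends_below s <= m)%N
  then Some (m - ends_below s + ends_above s)%N else None.

Fixpoint top (m : nat) (w : diagram) : option nat :=
  if w is s :: w' then obind (fun k => top k w') (slice_top m s) else Some m.

(** w is a diagram with m ends at the bottom and k ends at the top. *)
Definition has_ends (m k : nat) (w : diagram) : bool := top m w == Some k.

Definition link_diagram (w : diagram) : bool := has_ends 0 0 w.

(** The disc of a 2n-tangle is drawn with its 2n ends at the top. *)
Definition tangle_diagram (n : nat) (w : diagram) : bool := has_ends 0 n.*2 w.

Definition shift_slice (a : nat) (s : slice) : slice :=
  match s with
  | Cup i => Cup (a + i)
  | Cap i => Cap (a + i)
  | Cross b i => Cross b (a + i)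
  end.

(** w with a vertical strands added on its left. *)
Definition shift (a : nat) (w : diagram) : diagram := map (shift_slice a) w.

(** * Isotopy *)

(** The first five moves are the planar isotopies between sliced diagrams, the
  others are the Reidemeister moves. *)
Inductive move : diagram -> diagram -> Prop :=
  | move_commute s s' :
      move [:: shift_slice (position s + ends_below s) s'; s]
           [:: s; shift_slice (position s + ends_above s) s']
  | move_zigzag_left i : move [:: Cup i; Cap i.+1] [::]
  | move_zigzag_right i : move [:: Cup i.+1; Cap i] [::]
  | move_cross_cap b i :
      move [:: Cross b i; Cap i.+1] [:: Cross (~~ b) i.+1; Cap i]
  | move_cross_cup b i :
      move [:: Cup i.+1; Cross b i] [:: Cup i; Cross (~~ b) i.+1]
  | move_R1_cap b i : move [:: Cross b i; Cap i] [:: Cap i]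
  | move_R1_cup b i : move [:: Cup i; Cross b i] [:: Cup i]
  | move_R2 b i : move [:: Cross b i; Cross (~~ b) i] [::]
  | move_R3 b i :
      move [:: Cross b i; Cross b i.+1; Cross b i]
           [:: Cross b i.+1; Cross b i; Cross b i.+1].

Inductive move_in_diagram (m k : nat) : diagram -> diagram -> Prop :=
  | MoveInDiagram u v a b of
      move a b & has_ends m k (u ++ a ++ v) & has_ends m k (u ++ b ++ v) :
      move_in_diagram m k (u ++ a ++ v) (u ++ b ++ v).

(** Two diagrams represent the same tangle (with fixed ends). *)
Definition isotopic (m k : nat) : diagram -> diagram -> Prop :=
  clos_refl_sym_trans diagram (move_in_diagram m k).

(** Up to a planar isotopy, the disc of t is a thin box with all its ends at the
  top, and everything else at its height consists of vertical strands. *)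
Definition extends_to (t l : diagram) : Prop :=
  link_diagram l /\ exists u v a, l = u ++ shift a t ++ v.

Definition embeds (n : nat) (t l : diagram) : Prop :=
  exists t' l', [/\ isotopic 0 n.*2 t t', extends_to t' l' & isotopic 0 0 l' l].

(** * Closed components and Catalan tangles *)

(** We follow a diagram without bottom ends upwards. The state consists of a
  label for each strand, equal for exactly the two ends of the same arc, and of
  the number of components closed so far. *)
Definition trace_slice (st : seq nat * nat) (s : slice) : seq nat * nat :=
  let: (ls, c) := st in
  match s with
  | Cup i =>
      let x := (foldr maxn 0 ls).+1 in (take i ls ++ [:: x, x & drop i ls], c)
  | Cap i =>
      let x := nth 0%N ls i in
      let y := nth 0%N ls i.+1 in
      let rest := take i ls ++ drop i.+2 ls in
      if x == y then (rest, c.+1)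
      else ([seq if z == y then x else z | z <- rest], c)
  | Cross _ i =>
      (take i ls ++ [:: nth 0%N ls i.+1, nth 0%N ls i & drop i.+2 ls], c)
  end.

Definition closed_components (w : diagram) : nat :=
  (foldl trace_slice ([::], 0%N) w).2.

Definition crossingless (w : diagram) : bool :=
  all (fun s => if s is Cross _ _ then false else true) w.

Definition catalan (n : nat) (c : diagram) : bool :=
  [&& tangle_diagram n c, crossingless c & closed_components c == 0%N].

(** The rotation by pi about a horizontal axis of the plane of projection, which
  moves the ends of a tangle from top to bottom and preserves their order. *)
Definition flip_slice (s : slice) : slice :=
  match s with
  | Cup i => Cap i
  | Cap i => Cup i
  | Cross b i => Cross b i
  end.

Definition flip (w : diagram) : diagram := rev (map flip_slice w).

(** The link t^s. *)
Definition join (t s : diagram) : diagram := t ++ flip s.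

(** * The Kauffman bracket *)

(** The skein relation is applied to the crossings of w from bottom to top, with
  u the part already smoothed; the A-smoothing of [Cross true i] and the
  B-smoothing of [Cross false i] consist of two vertical strands. A
  crossingless diagram with c > 0 components has bracket delta^(c-1). *)
Fixpoint bracket_rec (u w : diagram) : laurent :=
  match w with
  | [::] => delta ^+ (closed_components u).-1
  | Cross true i :: w' =>
      A * bracket_rec u w' + Ainv * bracket_rec (u ++ [:: Cap i; Cup i]) w'
  | Cross false i :: w' =>
      A * bracket_rec (u ++ [:: Cap i; Cup i]) w' + Ainv * bracket_rec u w'
  | s :: w' => bracket_rec (rcons u s) w'
  end.

Definition bracket (w : diagram) : laurent := bracket_rec [::] w.

(** The bracket has its three defining properties: [bracket_unknot],
  [bracket_skein] and [bracket_loop]. The last one requires a nonempty link, as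
  the empty link has no bracket for which the relation holds. *)

Lemma bracket_unknot : bracket [:: Cup 0; Cap 0] = 1.
Proof. by []. Qed.

Lemma bracket_skein (w1 w2 : diagram) (b : bool) (i : nat) :
  bracket (w1 ++ Cross b i :: w2) =
  (if b then A else Ainv) * bracket (w1 ++ w2)
  + (if b then Ainv else A) * bracket (w1 ++ [:: Cap i, Cup i & w2]).
Proof.
rewrite /bracket; elim: w1 [::] => [|s w1 IH] u.
  have Eu : rcons (rcons u (Cap i)) (Cup i) = u ++ [:: Cap i; Cup i].
    by rewrite -!cats1 -catA.
  by case: b => /=; rewrite Eu // addrC.
have swap (a a' c c' x y z t : laurent) :
  a * (c * x + c' * y) + a' * (c * z + c' * t) =
  c * (a * x + a' * z) + c' * (a * y + a' * t).
  by rewrite !mulrDr !(mulrCA a) !(mulrCA a') addrACA.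
by case: s => [j|j|[] j] /=; rewrite !IH // swap.
Qed.

Lemma trace_closed_add ls c k w :
  foldl trace_slice (ls, (c + k)%N) w =
  ((foldl trace_slice (ls, c) w).1, ((foldl trace_slice (ls, c) w).2 + k)%N).
Proof.
elim: w ls c => [//|[i|i|d i] w IH] ls c /=; try exact: IH.
by case: ifP => _; rewrite -?addSn IH.
Qed.

Lemma trace_loop ls c i :
  (i <= size ls)%N ->
  foldl trace_slice (ls, c) [:: Cup i; Cap i] = (ls, c.+1).
Proof.
move=> le_i /=; set x := (foldr maxn 0%N ls).+1.
have sz : size (take i ls) = i by rewrite size_takel.
rewrite !nth_cat sz ltnn subnn ltnNge leqnSn subSnn /= eqxx.
rewrite take_cat sz ltnn subnn take0 cats0 drop_cat sz ltnNge -addn2 leq_addr /=.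
by rewrite addKn /= drop0 cat_take_drop.
Qed.

Lemma size_trace w m k ls c :
  size ls = m -> has_ends m k w -> size (foldl trace_slice (ls, c) w).1 = k.
Proof.
rewrite /has_ends.
elim: w m ls c => [|s w IH] m ls c sz_ls /=; first by move=> /eqP [<-].
rewrite /slice_top; case: ifP => //= le_s; case: s le_s => [i|i|d i] /= le_s.
- rewrite subn0 addn0 in le_s * => /IH; apply.
  by rewrite size_cat /= size_takel ?sz_ls // size_drop sz_ls; lia.
- rewrite addn0 => /IH IH'; case: ifP => _; apply: IH'.
    by rewrite size_cat size_takel ?size_drop sz_ls; lia.
  by rewrite size_map size_cat size_takel ?size_drop sz_ls; lia.
- move=> /IH; apply.
  by rewrite size_cat /= size_takel ?size_drop sz_ls; lia.
Qed.

Lemma has_ends_cat m k w1 w2 :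
  has_ends m k (w1 ++ w2) ->
  exists2 j, has_ends m j w1 & has_ends j k w2.
Proof.
rewrite /has_ends; elim: w1 m => [|s w1 IH] m /=; first by exists m.
by case: (slice_top m s) => //= j /IH.
Qed.

Lemma count_split (P : pred nat) (ls : seq nat) i : (i.+1 < size ls)%N ->
  count P ls = (P (nth 0 ls i) + P (nth 0 ls i.+1)
    + count P (take i ls ++ drop i.+2 ls))%N.
Proof.
move=> lt_i; rewrite -{1}(cat_take_drop i ls) (drop_nth 0%N) 1?ltnW //.
by rewrite (drop_nth 0%N) // !count_cat /=; lia.
Qed.

(** Every label occurs an even number of times. *)
Definition even_labels (ls : seq nat) : Prop :=
  forall x, ~~ odd (count_mem x ls).

Lemma even_labels_trace m ls c s k :
  size ls = m -> slice_top m s = Some k -> even_labels ls ->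
  even_labels (trace_slice (ls, c) s).1.
Proof.
rewrite /slice_top => sz; case: ifP => // + _ ev.
case: s => [i|i|d i] /= le_s.
- move=> x; have := ev x; rewrite -{1}(cat_take_drop i ls) !count_cat /=.
  by rewrite !oddD addKb.
- have lt_i : (i.+1 < size ls)%N by rewrite sz; lia.
  case: eqP => [e|/eqP ne] x.
    by have := ev x; rewrite (count_split _ lt_i) -e addnn oddD odd_double.
  set a := nth _ _ _ in ne *; set b := nth _ _ _ in ne *.
  set r := take i ls ++ _.
  have rE y : odd (count_mem y r) = (a == y) (+) (b == y).
    have := ev y; rewrite (count_split _ lt_i) -/a -/b -/r !oddD !oddb.
    by move=> /=; case: (a == y); case: (b == y); case: (odd _).
  rewrite count_map /= (_ : count _ r =
    ((x != b) * count_mem x r + (x == a) * count_mem b r)%N).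
    rewrite oddD !oddM !oddb !rE eqxx (negbTE ne) (eq_sym b) (eq_sym a).
    by case: (eqVneq x a) => [->|_]; rewrite ?ne ?(negbTE ne) //; case: (x == b).
  elim: r {rE} => [|z r IH] /=; first by rewrite !muln0.
  rewrite IH; case: (eqVneq z b) => [->|nzb].
    rewrite (eq_sym a x) (eq_sym b x).
    by case: (x == a); case: (x == b) => /=; lia.
  by case: (eqVneq z x) => [<-|_]; rewrite ?nzb /=; lia.
- have lt_i : (i.+1 < size ls)%N by rewrite sz; lia.
  move=> x; have := ev x; rewrite (count_split _ lt_i) !count_cat /=.
  by rewrite !oddD; do 4 case: (odd _).
Qed.

Lemma even_labels_foldl w m ls c k :
  size ls = m -> has_ends m k w -> even_labels ls ->
  even_labels (foldl trace_slice (ls, c) w).1.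
Proof.
elim: w m ls c => [//|s w IH] m ls c sz hw ev.
have [j hs hw'] := has_ends_cat (hw : has_ends m k ([:: s] ++ w)).
have sz' := size_trace c sz hs.
have ev' : even_labels (trace_slice (ls, c) s).1.
  move: hs; rewrite /has_ends /=; case E: (slice_top m s) => [k'|] // _.
  exact: even_labels_trace sz E ev.
rewrite -[foldl _ _ _]/(foldl trace_slice (trace_slice (ls, c) s) w).
move: sz' ev'; rewrite -[foldl _ _ [:: s]]/(trace_slice (ls, c) s).
by case: trace_slice => ls' c' sz' ev'; exact: IH sz' hw' ev'.
Qed.

Lemma closed_components_gt0 w :
  w <> [::] -> link_diagram w -> (0 < closed_components w)%N.
Proof.
case/lastP: w => // w s _; rewrite -cats1 => /has_ends_cat[j hw hs].
rewrite /closed_components foldl_cat.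
have ev : even_labels (foldl trace_slice ([::], 0%N) w).1.
  by apply: (even_labels_foldl 0 (erefl : size [::] = 0%N) hw) => x.
have := size_trace 0 (erefl : size [::] = 0%N) hw.
case: (foldl _ _ w) ev => ls c /= ev sz.
move: hs; rewrite /has_ends /= /slice_top.
case: s => [i|i|d i] /=; case: ifP => //= le_i /eqP [j0]; try lia.
have i0 : i = 0%N by lia.
have j2 : j = 2%N by lia.
case: ls ev sz => [|x [|y [|? ?]]] ev sz; move: sz; rewrite ?j2 // => _.
rewrite i0 /=; case: eqVneq => // ne.
by have := ev x; rewrite /= eqxx eq_sym (negbTE ne).
Qed.

Lemma top_cat m w1 w2 :
  top m (w1 ++ w2) = obind (fun k => top k w2) (top m w1).
Proof. by elim: w1 m => [//|s w1 IH] m /=; case: (slice_top m s). Qed.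

Lemma link_smoothing p w b i : link_diagram (p ++ Cross b i :: w) ->
  [/\ link_diagram (p ++ w), link_diagram (p ++ [:: Cap i, Cup i & w])
    & p ++ w <> [::]].
Proof.
rewrite /link_diagram /has_ends !top_cat; case E: (top 0 p) => [m|] //=.
rewrite /slice_top /=; case: ifP => //= le_i.
rewrite !addn0 (_ : (i <= m - 2)%N); last by lia.
rewrite /= subn0 !subnK; try lia.
move=> h; split=> //; case: p E => //= -[m0]; lia.
Qed.

Lemma link_loop p w i : link_diagram (p ++ [:: Cup i, Cap i & w]) ->
  link_diagram (p ++ w) /\ exists2 m, top 0 p = Some m & (i <= m)%N.
Proof.
rewrite /link_diagram /has_ends !top_cat; case E: (top 0 p) => [m|] //=.
rewrite /slice_top /= addn0 subn0; case: ifP => //= le_i.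
by rewrite leq_add2r le_i /= addn0 addnK; split; last by exists m.
Qed.

Lemma bracket_rec_loop u1 u2 i w :
  u1 ++ u2 ++ w <> [::] -> link_diagram (u1 ++ [:: Cup i, Cap i & u2 ++ w]) ->
  bracket_rec (u1 ++ [:: Cup i, Cap i & u2]) w =
  delta * bracket_rec (u1 ++ u2) w.
Proof.
elim: w u2 => [|s w IH] u2 ne hl.
  have [hl' [m Em le_i]] := link_loop hl.
  rewrite !cats0 in ne hl hl' *; rewrite /= -exprS; congr (_ ^+ _).
  have := closed_components_gt0 ne hl'; rewrite /closed_components.
  rewrite -[[:: _, _ & u2]]/([:: Cup i; Cap i] ++ u2) !foldl_cat.
  have := size_trace 0 (erefl : size [::] = 0%N) (introT eqP Em : has_ends 0 m u1).
  case: (foldl trace_slice _ u1) => ls c /= sz.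
  have := @trace_loop ls c i; rewrite sz => /(_ le_i) /= ->.
  by rewrite -[c.+1]addn1 trace_closed_add /= addn1 /= => /prednK.
have key u3 : u1 ++ u3 ++ w <> [::] ->
    link_diagram (u1 ++ [:: Cup i, Cap i & u3 ++ w]) ->
    bracket_rec (u1 ++ [:: Cup i, Cap i & u3]) w =
    delta * bracket_rec (u1 ++ u3) w by exact: IH.
have rc a : rcons (u1 ++ [:: Cup i, Cap i & u2]) a
            = u1 ++ [:: Cup i, Cap i & rcons u2 a].
  by rewrite rcons_cat.
have rc' a : rcons (u1 ++ u2) a = u1 ++ rcons u2 a by rewrite rcons_cat.
have cross b j : s = Cross b j ->
  bracket_rec (u1 ++ [:: Cup i, Cap i & u2]) w = delta * bracket_rec (u1 ++ u2) w
  /\ bracket_rec ((u1 ++ [:: Cup i, Cap i & u2]) ++ [:: Cap j; Cup j]) w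
     = delta * bracket_rec ((u1 ++ u2) ++ [:: Cap j; Cup j]) w.
  move=> Es; rewrite Es in ne hl.
  have [hl0 _] := link_loop hl.
  rewrite catA in hl0.
  have [_ _ ne0] := link_smoothing hl0.
  rewrite -[[:: _, _ & u2 ++ _]]/([:: Cup i; Cap i] ++ u2 ++ _) !catA in hl.
  have [h1 h2 _] := link_smoothing hl.
  split; first by apply: key; [rewrite catA|move: h1; rewrite -!catA].
  rewrite -!catA /=; apply: key; first by case: (u1) (u2) => // -[].
  by move: h2; rewrite -!catA.
case Es: s => [j|j|[] j] /=.
- by rewrite rc rc'; apply: key; rewrite cat_rcons -Es.
- by rewrite rc rc'; apply: key; rewrite cat_rcons -Es.
- by have [-> ->] := cross _ _ Es; rewrite mulrDr !(mulrCA delta).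
- by have [-> ->] := cross _ _ Es; rewrite mulrDr !(mulrCA delta).
Qed.

Lemma bracket_loop (w1 w2 : diagram) (i : nat) :
  w1 ++ w2 <> [::] -> link_diagram (w1 ++ [:: Cup i, Cap i & w2]) ->
  bracket (w1 ++ [:: Cup i, Cap i & w2]) = delta * bracket (w1 ++ w2).
Proof.
suff gen u : (u ++ w1) ++ w2 <> [::] ->
    link_diagram ((u ++ w1) ++ [:: Cup i, Cap i & w2]) ->
    bracket_rec u (w1 ++ [:: Cup i, Cap i & w2]) =
    delta * bracket_rec u (w1 ++ w2) by move=> ne hl; exact: (gen [::] ne hl).
elim: w1 u => [|s w1 IH] u ne hl.
  rewrite !cats0 /= in ne hl *.
  have := @bracket_rec_loop u [::] i w2 ne hl.
  by rewrite cats0 -!cats1 -catA.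
have IHs v : (v ++ w1) ++ w2 <> [::] ->
    link_diagram ((v ++ w1) ++ [:: Cup i, Cap i & w2]) ->
    bracket_rec v (w1 ++ [:: Cup i, Cap i & w2]) =
    delta * bracket_rec v (w1 ++ w2) by exact: IH.
have cross b j : s = Cross b j ->
  bracket_rec u (w1 ++ [:: Cup i, Cap i & w2]) = delta * bracket_rec u (w1 ++ w2)
  /\ bracket_rec (u ++ [:: Cap j; Cup j]) (w1 ++ [:: Cup i, Cap i & w2])
     = delta * bracket_rec (u ++ [:: Cap j; Cup j]) (w1 ++ w2).
  move=> Es; rewrite Es in ne hl.
  have [hl0 _] := link_loop hl.
  rewrite -catA /= in hl0; have [_ _ ne0] := link_smoothing hl0.
  rewrite -catA /= in hl; have [h1 h2 _] := link_smoothing hl.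
  split; first by apply: IHs; rewrite -catA.
  by apply: IHs; rewrite -!catA //; case: (u).
case Es: s => [j|j|[] j] /=.
- by apply: IHs; rewrite cat_rcons -Es.
- by apply: IHs; rewrite cat_rcons -Es.
- by have [-> ->] := cross _ _ Es; rewrite mulrDr !(mulrCA delta).
- by have [-> ->] := cross _ _ Es; rewrite mulrDr !(mulrCA delta).
Qed.

(** The ideal I_t generated by the brackets of t^c for the Catalan tangles c. *)
Definition tangle_ideal (n : nat) (t : diagram) : laurent -> Prop :=
  ideal_generated (fun x => exists2 c, catalan n c & x = bracket (join t c)).

(* Main.v *)
(** By naturality, a strand can be swept across a whole tangle without changing
  the bracket. If l = u ++ shift a t ++ v, sweeping the a strands on the left of t
  to its right, and then sliding t below u, gives a diagram t ++ w with the same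
  bracket. Smoothing the crossings of w, and cancelling every minimum of the
  result against the maxima above it, writes <t ++ w> as a combination of brackets
  <t ++ q>, where q consists of maxima only; such a q is a Catalan tangle upside
  down. The Reidemeister moves multiply the brackets by units, so they change
  neither membership in the ideal nor the ideal itself. *)

Require Import Defs.
From mathcomp Require Import all_boot all_algebra ring zify.

Set Implicit Arguments.
Unset Strict Implicit.
Unset Printing Implicit Defensive.

Import GRing.Theory.
Local Open Scope ring_scope.

(** * Closed components under planar isotopy *)

(** In the middle of a sliced diagram, [t] has strands on both sides, so what surrounds it is not
    itself a composable diagram; this is why [t] has to reach the bottom. The sweeps add crossings,
    but outside [t], where the skein relation turns them into coefficients that membership in an
    ideal ignores. All equalities of brackets are local: two diagrams with the same ends are
    compared inside every closed diagram. By the skein relation, contexts without crossings suffice,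
    and moves of crossings reduce to moves of maxima and minima. What remains is to count
    components, for which only the partition of the strands into arcs matters, not the labels that
    [trace_slice] happens to choose. *)

Definition relabel (x y z : nat) : nat := if z == y then x else z.

(** The labellings s and s' induce the same partition of the positions. *)
Definition similar (s s' : seq nat) : Prop :=
  exists2 r : seq (nat * nat), s = unzip1 r /\ s' = unzip2 r
    & {in r &, forall p q, (p.1 == q.1) = (p.2 == q.2)}.

Lemma similar_refl s : similar s s.
Proof.
exists [seq (x, x) | x <- s].
  by rewrite /unzip1 /unzip2 -!map_comp; split; rewrite map_id_in.
by move=> _ _ /mapP[x _ ->] /mapP[y _ ->].
Qed.

Lemma similar_map (f g : nat -> nat) s :
  {in s &, forall x y, (f x == f y) = (g x == g y)} -> similar (map f s) (map g s).
Proof.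
move=> fg; exists [seq (f x, g x) | x <- s].
  by rewrite /unzip1 /unzip2 -!map_comp; split; apply: eq_map.
by move=> _ _ /mapP[x xs ->] /mapP[y ys ->]; apply: fg.
Qed.

Lemma similar_size s s' : similar s s' -> size s = size s'.
Proof. by case=> r [-> ->] _; rewrite !size_map. Qed.

Lemma similar_insert x x' p q p' q' : size p = size p' ->
  x \notin p ++ q -> x' \notin p' ++ q' -> similar (p ++ q) (p' ++ q') ->
  similar (p ++ [:: x, x & q]) (p' ++ [:: x', x' & q']).
Proof.
move=> sz xs xs' [r [Es Es'] inj].
have Ep : p = map fst (take (size p) r).
  by rewrite map_take -/(unzip1 r) -Es take_size_cat.
have Ep' : p' = map snd (take (size p) r).
  by rewrite map_take -/(unzip2 r) -Es' sz take_size_cat.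
have Eq : q = map fst (drop (size p) r).
  by rewrite map_drop -/(unzip1 r) -Es drop_size_cat.
have Eq' : q' = map snd (drop (size p) r).
  by rewrite map_drop -/(unzip2 r) -Es' sz drop_size_cat.
exists (take (size p) r ++ [:: (x, x'), (x, x') & drop (size p) r]).
  by rewrite /unzip1 /unzip2 !map_cat !map_cons -Ep -Ep' -Eq -Eq'.
have fresh a : a \in r -> (x == a.1) = false /\ (x' == a.2) = false.
  move=> ar; split; apply/negbTE.
    by apply: contraNneq xs => ->; rewrite Es map_f.
  by apply: contraNneq xs' => ->; rewrite Es' map_f.
have mem a : a \in take (size p) r ++ [:: (x, x'), (x, x') & drop (size p) r] ->
    a = (x, x') \/ a \in r.
  rewrite -{3}(cat_take_drop (size p) r) !mem_cat !inE.
  by case: eqP => [->|_]; [left | right].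
move=> a b /mem[->|ar] /mem[->|br] /=; rewrite ?eqxx //.
- by have [-> ->] := fresh _ br.
- by rewrite ![_ == x]eq_sym ![_ == x']eq_sym; have [-> ->] := fresh _ ar.
- exact: inj.
Qed.

Lemma fresh_notin s : (foldr maxn 0%N s).+1 \notin s.
Proof.
suff ub x : x \in s -> (x <= foldr maxn 0%N s)%N.
  by apply/negP => /ub; rewrite ltnn.
elim: s => //= y s IH; rewrite inE => /orP[/eqP->|/IH]; first exact: leq_maxl.
by move=> le_x; rewrite leq_max le_x orbT.
Qed.

(** Only the freshness of the new label affects the partition, so its value is hidden. *)
Lemma trace_cup ls p q c i : ls = p ++ q -> size p = i ->
  exists2 x, x \notin ls &
    trace_slice (ls, c) (Cup i) = (p ++ [:: x, x & q], c).
Proof.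
move=> -> <-; exists (foldr maxn 0%N (p ++ q)).+1; first exact: fresh_notin.
by rewrite /= take_size_cat // drop_size_cat.
Qed.

(** Both cases of [trace_slice] become one formula: when a component closes, [relabel x x] is the
    identity and [x == y] counts the component. *)
Lemma trace_cap ls p x y q c i : ls = p ++ [:: x, y & q] -> size p = i ->
  trace_slice (ls, c) (Cap i) = (map (relabel x y) (p ++ q), ((x == y) + c)%N).
Proof.
move=> -> <- /=; rewrite take_size_cat // -addn2 addnC -drop_drop drop_size_cat //=.
rewrite !nth_cat ltnn subnn ltnNge leqnSn subSnn /= drop0.
case: (eqVneq x y) => [->|_] //=; congr pair.
by rewrite map_id_in // => z _; rewrite /relabel; case: eqP.
Qed.

Arguments trace_slice : simpl never.

Definition similar_state (st st' : seq nat * nat) : Prop :=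
  similar st.1 st'.1 /\ st.2 = st'.2.

Lemma split_at (T : Type) (s : seq T) i :
  (i <= size s)%N -> exists p q, s = p ++ q /\ size p = i.
Proof.
by move=> le_i; exists (take i s), (drop i s); rewrite cat_take_drop size_takel.
Qed.

Lemma split_two (T : Type) (s : seq T) i : (i.+2 <= size s)%N ->
  exists p q x y, s = p ++ [:: x, y & q] /\ size p = i.
Proof.
move=> le_i; exists (take i s), (drop i.+2 s).
have sz : size (take i s) = i by rewrite size_takel; lia.
have := size_drop i s; rewrite -{3}(cat_take_drop i s) -(add2n i) -drop_drop.
case: (drop i s) => [|x [|y q]] /=; try lia.
by exists x, y; rewrite drop0.
Qed.

Lemma similar_state_slice st st' s k :
  (if s is Cross _ _ then false else true) ->
  slice_top (size st.1) s = Some k -> similar_state st st' ->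
  similar_state (trace_slice st s) (trace_slice st' s).
Proof.
case: st st' => [ls c] [ls' c'] /= ncr; rewrite /slice_top; case: ifP => // le_s _.
move=> [/= sim <-]; case: s ncr le_s => [i|i|//] _ le_i.
  have le_i' : (i <= size ls)%N by move: le_i; rewrite /= addn0.
  have [p [q [Els szp]]] := split_at le_i'.
  have le_i2 : (i <= size ls')%N by rewrite -(similar_size sim).
  have [p' [q' [Els' szp']]] := split_at le_i2.
  have [x xls ->] := trace_cup c Els szp.
  have [x' xls' ->] := trace_cup c Els' szp'.
  rewrite Els in sim xls; rewrite Els' in sim xls'.
  by split=> //=; apply: similar_insert sim; rewrite ?szp.
case: sim => r [Els ->] inj.
have [p [q [x [y [Er sz]]]]] : exists p q x y, r = p ++ [:: x, y & q] /\ size p = i.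
  by apply: split_two; move: le_i => /=; rewrite Els size_map addn2.
have E f : [seq f a | a <- r] = map f p ++ [:: f x, f y & map f q] :> seq nat.
  by rewrite Er map_cat.
rewrite {}Els !(trace_cap _ (E _)) ?size_map //.
have mem a : a \in p ++ q -> a \in r.
  by rewrite Er !mem_cat !inE => /orP[->|->]; rewrite ?orbT.
have xr : x \in r by rewrite Er mem_cat !inE eqxx orbT.
have yr : y \in r by rewrite Er mem_cat !inE eqxx !orbT.
(* Similar labellings close a component at the same time. *)
split; last by rewrite /= (inj x y).
rewrite /= -!map_cat -!map_comp.
exists [seq (relabel x.1 y.1 a.1, relabel x.2 y.2 a.2) | a <- p ++ q].
  by rewrite /unzip1 /unzip2 -!map_comp; split; apply: eq_map.
move=> _ _ /mapP[a /mem ar ->] /mapP[b /mem br ->] /=.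
rewrite /relabel (inj a y) // (inj b y) //.
by do 2 case: ifP => _; rewrite ?eqxx // inj.
Qed.

Lemma similar_state_trace w st st' m k :
  crossingless w -> size st.1 = m -> has_ends m k w -> similar_state st st' ->
  similar_state (foldl trace_slice st w) (foldl trace_slice st' w).
Proof.
elim: w st st' m => [|s w IH] st st' m //= /andP[ncr cw] sz.
rewrite /has_ends /=; case E: (slice_top m s) => [j|] //= hw sim.
have E' : slice_top (size st.1) s = Some j by rewrite sz.
apply: (IH _ _ j) => //; last exact: similar_state_slice ncr E' sim.
case: st sz {sim E'} => ls c /= sz; apply: (@size_trace [:: s] m j ls c sz).
by rewrite /has_ends /= E.
Qed.

(** * Exchanges and zigzags of maxima and minima *)

(** Fresh labels depend on the order of the slices, so the final labellings are compared only up to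
    similarity. *)
Definition trace_eq (m : nat) (a b : diagram) : Prop := forall ls c, size ls = m ->
  similar_state (foldl trace_slice (ls, c) a) (foldl trace_slice (ls, c) b).

Lemma relabel_in x y z (s : seq nat) : x \in s -> z \in s -> relabel x y z \in s.
Proof. by rewrite /relabel; case: eqP. Qed.

Lemma relabel_l x y : relabel x y x = x.
Proof. by rewrite /relabel; case: eqP. Qed.

Lemma relabel_r x y : relabel x y y = x.
Proof. by rewrite /relabel eqxx. Qed.

Lemma relabel_absorb (g : nat -> nat) x y a : g x = g y -> g (relabel x y a) = g a.
Proof. by rewrite /relabel; case: eqP => // ->. Qed.

Definition relabel2 x y z w a : nat :=
  relabel (relabel z w x) (relabel z w y) (relabel z w a).

(** Merging z with w and then x with y gives a labelling that is constant on the
  classes of the other order of merging, hence the two orders are similar. *)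
Lemma relabel2_absorb x y z w a :
  relabel2 x y z w (relabel2 z w x y a) = relabel2 x y z w a.
Proof.
have eq_zw : relabel2 x y z w z = relabel2 x y z w w.
  by rewrite /relabel2 relabel_l relabel_r.
have eq_xy : relabel2 x y z w x = relabel2 x y z w y.
  by rewrite /relabel2 relabel_l relabel_r.
by rewrite {2}/relabel2 !relabel_absorb.
Qed.

Lemma relabel_fresh x y z : z != y -> relabel x y z = z.
Proof. by rewrite /relabel => /negbTE->. Qed.

Lemma trace_eq_cup_cup m i j : (i + j <= m)%N ->
  trace_eq m [:: Cup (i + j); Cup i] [:: Cup i; Cup (i + 2 + j)].
Proof.
move=> le_ij ls c sz.
have le_i : (i <= size ls)%N by lia.
have [p [s [E szp]]] := split_at le_i.
have le_j : (j <= size s)%N by move: sz; rewrite E size_cat; lia.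
have [q [r [Es szq]]] := split_at le_j.
rewrite /= {}E {}Es.
have [x xF ->] := @trace_cup (p ++ q ++ r) (p ++ q) r c (i + j)
  (catA _ _ _) ltac:(by rewrite size_cat szp szq).
have [y yF ->] := @trace_cup ((p ++ q) ++ [:: x, x & r]) p (q ++ [:: x, x & r])
  c i (esym (catA _ _ _)) szp.
have [x' x'F ->] := @trace_cup (p ++ q ++ r) p (q ++ r) c i erefl szp.
have [y' y'F ->] := @trace_cup (p ++ [:: x', x' & q ++ r])
  (p ++ [:: x', x' & q]) r c (i + 2 + j) ltac:(by rewrite -catA)
  ltac:(by rewrite size_cat /= szp szq; lia).
split=> //=; rewrite -catA /=; rewrite -catA in yF.
move: y'F; rewrite !(mem_cat, inE) !negb_or => /and5P[y'p y'x' _ y'q y'r].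
(* The left pairs [y] and [x'] correspond, and so do the right pairs [x] and [y'], although they are
   created in opposite orders. *)
apply: similar_insert => //.
  move: x'F; rewrite !(mem_cat, inE) !negb_or => /and3P[-> -> ->].
  by rewrite !(eq_sym x') y'x'.
rewrite !catA; apply: similar_insert; rewrite -?catA //; last exact: similar_refl.
by rewrite !mem_cat !negb_or y'p y'q.
Qed.

Lemma trace_eq_cap_cup m i j : (i + 2 + j <= m)%N ->
  trace_eq m [:: Cup (i + 2 + j); Cap i] [:: Cap i; Cup (i + j)].
Proof.
move=> le_ij ls c sz.
have le_i : (i.+2 <= size ls)%N by lia.
have [p [s [x [y [E szp]]]]] := split_two le_i.
have le_j : (j <= size s)%N by move: sz; rewrite E size_cat /=; lia.
have [q [r [Es szq]]] := split_at le_j.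
rewrite /= {}E {}Es.
have [f fF ->] := @trace_cup (p ++ [:: x, y & q ++ r]) (p ++ [:: x, y & q]) r
  c (i + 2 + j) ltac:(by rewrite -catA)
  ltac:(by rewrite size_cat /= szp szq; lia).
rewrite -catA /= (trace_cap _ erefl szp) (trace_cap _ erefl szp).
rewrite !map_cat /=.
have [g gF ->] := @trace_cup (map (relabel x y) p ++ map (relabel x y) q ++
  map (relabel x y) r) (map (relabel x y) p ++ map (relabel x y) q)
  (map (relabel x y) r) ((x == y) + c) (i + j) (catA _ _ _)
  ltac:(by rewrite size_cat !size_map szp szq).
(* The maximum renames only [y], which differs from the fresh label [f]. *)
rewrite relabel_fresh; last first.
  by apply: contraNneq fF => ->; rewrite !(mem_cat, inE) eqxx !orbT.
split=> //=; rewrite catA; apply: similar_insert; rewrite -?catA //.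
  rewrite -!map_cat; apply: contra fF => /mapP[z zin ->].
  apply: relabel_in; first by rewrite !(mem_cat, inE) eqxx !orbT.
  by move: zin; rewrite !(mem_cat, inE) => /or3P[->|->|->]; rewrite ?orbT.
exact: similar_refl.
Qed.

Lemma trace_eq_cup_cap m i j : (i + j + 2 <= m)%N ->
  trace_eq m [:: Cap (i + j); Cup i] [:: Cup i; Cap (i + 2 + j)].
Proof.
move=> le_ij ls c sz.
have le_i : (i <= size ls)%N by lia.
have [p [s [E szp]]] := split_at le_i.
have le_j : (j.+2 <= size s)%N by move: sz; rewrite E size_cat /=; lia.
have [q [r [x [y [Es szq]]]]] := split_two le_j.
rewrite /= {}E {}Es.
have [f fF ->] := @trace_cup (p ++ q ++ [:: x, y & r]) p (q ++ [:: x, y & r])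
  c i erefl szp.
rewrite (@trace_cap _ (p ++ q) x y r c (i + j) (catA _ _ _));
  last by rewrite size_cat szp szq.
rewrite (@trace_cap _ (p ++ [:: f, f & q]) x y r c (i + 2 + j));
  [|by rewrite -catA|by rewrite size_cat /= szp szq; lia].
rewrite -!catA /= !map_cat /=.
have [g gF ->] := @trace_cup (map (relabel x y) p ++ map (relabel x y) q ++
  map (relabel x y) r) (map (relabel x y) p) (map (relabel x y) q ++
  map (relabel x y) r) ((x == y) + c) i erefl ltac:(by rewrite size_map szp).
rewrite relabel_fresh; last first.
  by apply: contraNneq fF => ->; rewrite !(mem_cat, inE) eqxx !orbT.
split=> /=; rewrite ?map_cat //; apply: similar_insert => //; last exact: similar_refl.
rewrite -!map_cat; apply: contra fF => /mapP[z zin ->].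
apply: relabel_in; first by rewrite !(mem_cat, inE) eqxx !orbT.
by move: zin; rewrite !(mem_cat, inE) => /or3P[->|->|->]; rewrite ?orbT.
Qed.

Lemma trace_eq_cap_cap m i j : (i + 2 + j + 2 <= m)%N ->
  trace_eq m [:: Cap (i + 2 + j); Cap i] [:: Cap i; Cap (i + j)].
Proof.
move=> le_ij ls c sz.
have le_i : (i.+2 <= size ls)%N by lia.
have [p [s [x [y [E szp]]]]] := split_two le_i.
have le_j : (j.+2 <= size s)%N by move: sz; rewrite E size_cat /=; lia.
have [q [r [z [w [Es szq]]]]] := split_two le_j.
rewrite /= {}E {}Es.
rewrite (@trace_cap _ (p ++ [:: x, y & q]) z w r c (i + 2 + j));
  [|by rewrite -catA|by rewrite size_cat /= szp szq; lia].
rewrite (@trace_cap _ p x y (q ++ [:: z, w & r]) c i erefl szp).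
rewrite -catA /= !map_cat /=.
rewrite (trace_cap _ erefl) ?size_map //.
rewrite (trace_cap _ (catA _ _ _)) ?size_cat ?size_map ?szp ?szq //.
rewrite -!map_cat -!map_comp catA; split=> /=; last first.
  (* Both orders count the independent cycles of the graph on the labels with edges xy and zw. *)
  by rewrite /relabel; do 4 case: ifP; lia.
rewrite -catA; apply: similar_map => a b _ _ /=.
rewrite -/(relabel2 x y z w a) -/(relabel2 x y z w b).
rewrite -/(relabel2 z w x y a) -/(relabel2 z w x y b).
by apply/eqP/eqP => e; rewrite -relabel2_absorb e relabel2_absorb.
Qed.

Lemma trace_eq_zigzag_left m i : (i < m)%N ->
  trace_eq m [:: Cup i; Cap i.+1] [::].
Proof.
move=> lt_i ls c sz.
have le_i : (i <= size ls)%N by lia.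
have [p [[|z r] [E szp]]] := split_at le_i; first by move: lt_i; rewrite -sz E cats0; lia.
rewrite /= {}E.
have [f fF ->] := trace_cup c (erefl (p ++ z :: r)) szp.
rewrite (@trace_cap _ (p ++ [:: f]) f z r);
  [|by rewrite -catA|by rewrite size_cat /= szp; lia].
have fz : (f == z) = false.
  by apply: contraNF fF => /eqP->; rewrite mem_cat inE eqxx orbT.
split=> /=; last by rewrite fz.
(* The strand goes on under the name [f], so the result is a renaming of the old labelling. *)
have -> : map (relabel f z) ((p ++ [:: f]) ++ r) = map (relabel f z) (p ++ z :: r).
  by rewrite -catA !map_cat /= /relabel eqxx fz.
rewrite -[X in similar _ X]map_id; apply: similar_map => a b ain bin.
have af : (a == f) = false by apply: contraNF fF => /eqP <-.
have bf : (b == f) = false by apply: contraNF fF => /eqP <-.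
rewrite /relabel; case: (eqVneq a z) => [->|az]; case: (eqVneq b z) => [ebz|bz];
  rewrite ?eqxx //; first by rewrite eq_sym bf.
by rewrite af ebz (negbTE az).
Qed.

(** Here the old label survives the maximum, so the labelling does not change at all. *)
Lemma trace_eq_zigzag_right m i : (i < m)%N ->
  trace_eq m [:: Cup i.+1; Cap i] [::].
Proof.
move=> lt_i ls c sz.
have le_i : (i <= size ls)%N by lia.
have [p [[|z r] [E szp]]] := split_at le_i; first by move: lt_i; rewrite -sz E cats0; lia.
rewrite /= {}E.
have [f fF ->] := @trace_cup _ (p ++ [:: z]) r c i.+1 (catA p [:: z] r)
   ltac:(by rewrite size_cat /= szp; lia).
rewrite -catA /= (trace_cap _ erefl szp).
have zf : (z == f) = false.
  by apply: contraNF fF => /eqP<-; rewrite !mem_cat inE eqxx orbT.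
split=> /=; last by rewrite zf.
have fixed a : a \in p ++ z :: r -> relabel z f a = a.
  by move=> ain; rewrite relabel_fresh //; apply: contraNneq fF => <-.
rewrite map_cat /= relabel_r !map_id_in; first exact: similar_refl.
  by move=> a ain; apply: fixed; rewrite !(mem_cat, inE) ain !orbT.
by move=> a ain; apply: fixed; rewrite !(mem_cat, inE) ain.
Qed.

(** * Moves that preserve the bracket *)

Lemma has_ends_comp m j k a b :
  has_ends m j a -> has_ends j k b -> has_ends m k (a ++ b).
Proof. by rewrite /has_ends top_cat => /eqP->. Qed.

Lemma has_ends_fun m k k' a : has_ends m k a -> has_ends m k' a -> k = k'.
Proof. by rewrite /has_ends => /eqP-> /eqP[]. Qed.

Lemma has_ends_cons m k s w : has_ends m k (s :: w) ->
  exists2 j, has_ends m j [:: s] & has_ends j k w.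
Proof. by rewrite -cat1s => /has_ends_cat. Qed.

Lemma has_ends_cup m k i :
  has_ends m k [:: Cup i] = (i <= m)%N && (k == m + 2)%N.
Proof. by rewrite /has_ends /= /slice_top /= addn0 subn0; case: ifP => // _; rewrite eq_sym. Qed.

Lemma has_ends_cap m k i :
  has_ends m k [:: Cap i] = (i + 2 <= m)%N && (k + 2 == m)%N.
Proof.
rewrite /has_ends /= /slice_top /= addn0; case: ifP => //= le_i.
by apply/eqP/eqP => [[<-]|<-]; [rewrite subnK //; lia | rewrite addnK].
Qed.

Lemma has_ends_cross m k b i :
  has_ends m k [:: Cross b i] = (i + 2 <= m)%N && (k == m).
Proof.
rewrite /has_ends /= /slice_top /=; case: ifP => //= le_i.
rewrite subnK; last by lia.
by rewrite eq_sym.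
Qed.

Definition has_ends_slice := (has_ends_cup, has_ends_cap, has_ends_cross).

Lemma has_ends_smooth m k p b i q : has_ends m k (p ++ Cross b i :: q) ->
  has_ends m k (p ++ q) /\ has_ends m k (p ++ [:: Cap i, Cup i & q]).
Proof.
move=> /has_ends_cat[j hp /has_ends_cons[j']].
rewrite has_ends_cross => /andP[le_i /eqP->] hq; split; first exact: has_ends_comp hq.
apply: has_ends_comp hp _; rewrite -[[:: _, _ & q]]/([:: Cap i] ++ [:: Cup i] ++ q).
apply: (@has_ends_comp _ (j - 2)); first by rewrite has_ends_slice; lia.
by apply: has_ends_comp hq; rewrite has_ends_slice; lia.
Qed.

Lemma crossingless_cat p q :
  crossingless (p ++ q) = crossingless p && crossingless q.
Proof. exact: all_cat. Qed.

Lemma bracket_crossingless w :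
  crossingless w -> bracket w = delta ^+ (closed_components w).-1.
Proof.
rewrite /bracket -[in closed_components w](cat0s w).
elim: w [::] => [|s w IH] u; first by rewrite cats0.
by case: s => [i|i|//] /= cw; rewrite IH // cat_rcons.
Qed.

(** * Equality of brackets in every context *)

Definition crossings (w : diagram) : nat :=
  count (fun s => if s is Cross _ _ then true else false) w.

Lemma crossing_split w :
  crossingless w \/ exists p b i q, w = p ++ Cross b i :: q.
Proof.
elim: w => [|s w [cw|[p [b [i [q ->]]]]]]; first by left.
  by case: s => [i|i|b i]; [left|left|right; exists [::], b, i, w].
by right; exists (s :: p), b, i, q.
Qed.

(** Testing on all closures makes the relation stable under composition, so that it serves as
    equality up to the factor [g] of morphisms of a skein category. *)
Definition ctx_eq (g : laurent) (m k : nat) (a b : diagram) : Prop :=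
  forall u v, has_ends 0 m u -> has_ends k 0 v ->
  bracket (u ++ a ++ v) = g * bracket (u ++ b ++ v).

(** Induction on the number of crossings of the context: smoothing one of them expands both sides
    with the same coefficients and keeps the numbers of ends. *)
Lemma ctx_eq_lift g m k a b :
  (forall u v, has_ends 0 m u -> has_ends k 0 v -> crossingless u ->
    crossingless v -> bracket (u ++ a ++ v) = g * bracket (u ++ b ++ v)) ->
  ctx_eq g m k a b.
Proof.
move=> eq0 u v.
have [N] := ubnP (crossings (u ++ v)); elim: N u v => // N IH u v.
rewrite /crossings count_cat => ltN hu hv.
have combine (x y x1 x2 z1 z2 : laurent) : x1 = g * z1 -> x2 = g * z2 ->
    x * x1 + y * x2 = g * (x * z1 + y * z2).
  by move=> -> ->; rewrite mulrDr !(mulrCA g).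
have [cu|[p [c [i [q Eu]]]]] := crossing_split u; last first.
  move: ltN hu; rewrite Eu count_cat /= => ltN /has_ends_smooth[hu1 hu2].
  rewrite -!catA !cat_cons !bracket_skein; apply: combine.
    rewrite !(catA p); apply: IH => //.
    by rewrite /crossings !count_cat; lia.
  rewrite -!cat_cons !(catA p); apply: IH => //.
  by rewrite /crossings !count_cat /=; lia.
have [cv|[p [c [i [q Ev]]]]] := crossing_split v; first exact: eq0.
move: ltN hv; rewrite Ev count_cat /= => ltN /has_ends_smooth[hv1 hv2].
rewrite !(catA a) !(catA b) !(catA u) !bracket_skein; apply: combine.
  rewrite -!catA; apply: IH => //.
  by rewrite /crossings !count_cat; lia.
rewrite -!catA; apply: IH => //.
by rewrite /crossings !count_cat /=; lia.
Qed.

Lemma ctx_eq_planar m k a b : has_ends m k a -> crossingless a -> crossingless b ->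
  trace_eq m a b -> ctx_eq 1 m k a b.
Proof.
move=> ha ca cb tr; apply: ctx_eq_lift => u v hu hv cu cv.
rewrite mul1r !bracket_crossingless ?crossingless_cat ?cu ?cv ?ca ?cb //.
congr (_ ^+ _.-1); rewrite /closed_components !foldl_cat.
have szu := size_trace 0 (erefl : size [::] = 0%N) hu.
case: (foldl trace_slice _ u) szu => ls c /= szu.
by have [] := similar_state_trace cv (size_trace c szu ha) hv (tr ls c szu).
Qed.

Lemma ctx_eq_refl m k a : ctx_eq 1 m k a a.
Proof. by move=> u v _ _; rewrite mul1r. Qed.

Lemma ctx_eq_trans g h m k a b c :
  ctx_eq g m k a b -> ctx_eq h m k b c -> ctx_eq (g * h) m k a c.
Proof. by move=> ab bc u v hu hv; rewrite ab // bc // mulrA. Qed.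

Lemma ctx_eq_trans1 m k b a c :
  ctx_eq 1 m k a b -> ctx_eq 1 m k b c -> ctx_eq 1 m k a c.
Proof. by move=> ab /(ctx_eq_trans ab); rewrite mul1r. Qed.

Lemma ctx_eq_sym m k a b : ctx_eq 1 m k a b -> ctx_eq 1 m k b a.
Proof. by move=> ab u v hu hv; rewrite mul1r ab // mul1r. Qed.

Lemma ctx_eq_cat g m k m' k' p q a b :
  has_ends m' m p -> has_ends k k' q -> ctx_eq g m k a b ->
  ctx_eq g m' k' (p ++ a ++ q) (p ++ b ++ q).
Proof.
move=> hp hq ab u v hu hv; rewrite -!catA !(catA u); apply: ab.
  exact: has_ends_comp hp.
exact: has_ends_comp hq hv.
Qed.

Lemma ctx_eq_catl g m k m' p a b : has_ends m' m p -> ctx_eq g m k a b ->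
  ctx_eq g m' k (p ++ a) (p ++ b).
Proof.
have h0 : has_ends k k [::] by rewrite /has_ends.
by move=> hp /(ctx_eq_cat hp h0); rewrite !cats0.
Qed.

Lemma ctx_eq_catr g m k k' q a b : has_ends k k' q -> ctx_eq g m k a b ->
  ctx_eq g m k' (a ++ q) (b ++ q).
Proof.
have h0 : has_ends m m [::] by rewrite /has_ends.
by move=> hq /(ctx_eq_cat h0 hq).
Qed.

Lemma ctx_skein p b i q u v :
  bracket (u ++ (p ++ Cross b i :: q) ++ v) =
  (if b then A else Ainv) * bracket (u ++ (p ++ q) ++ v)
  + (if b then Ainv else A) * bracket (u ++ (p ++ [:: Cap i, Cup i & q]) ++ v).
Proof. by rewrite -!catA !cat_cons !(catA u) bracket_skein -!cat_cons. Qed.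

(** Crossings of the same type have the same coefficients, so it is enough to compare the two
    smoothings; this removes crossings from the moves below. *)
Lemma ctx_eq_skein m k b i j p q p' q' :
  ctx_eq 1 m k (p ++ q) (p' ++ q') ->
  ctx_eq 1 m k (p ++ [:: Cap i, Cup i & q]) (p' ++ [:: Cap j, Cup j & q']) ->
  ctx_eq 1 m k (p ++ Cross b i :: q) (p' ++ Cross b j :: q').
Proof.
by move=> e1 e2 u v hu hv; rewrite mul1r !ctx_skein e1 // e2 // !mul1r.
Qed.

Lemma ctx_eq_loop m i u v : has_ends 0 m u -> has_ends m 0 v -> (i <= m)%N ->
  u ++ v <> [::] -> bracket (u ++ [:: Cup i; Cap i] ++ v) = delta * bracket (u ++ v).
Proof.
move=> hu hv le_i ne; rewrite cat_cons cat1s bracket_loop //.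
apply: has_ends_comp hu _; rewrite -cat1s -(cat1s (Cap i)).
apply: (@has_ends_comp _ (m + 2)); first by rewrite has_ends_slice; lia.
by apply: has_ends_comp hv; rewrite has_ends_slice; lia.
Qed.

Ltac ends_in H :=
  move: H; rewrite /has_ends /= /slice_top /=; do ?[case: ifP => //= ?];
  move=> /eqP[?].

Ltac ends :=
  rewrite /has_ends /= /slice_top /=; do ?[case: ifP => //= ?]; try lia;
  apply/eqP; congr Some; lia.

(** A smoothed crossing is either nothing or a maximum followed by a minimum, and each of these
    passes the other slice separately. Hence [planar] treats no crossing, [half] allows one in [t'],
    and the end of the proof one in [s]. *)
Lemma ctx_eq_commute s s' m k :
  has_ends m k [:: shift_slice (position s + ends_below s) s'; s] ->
  ctx_eq 1 m k [:: shift_slice (position s + ends_below s) s'; s]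
               [:: s; shift_slice (position s + ends_above s) s'].
Proof.
have planar t t' m1 k1 : crossingless [:: t; t'] ->
    has_ends m1 k1 [:: shift_slice (position t + ends_below t) t'; t] ->
    ctx_eq 1 m1 k1 [:: shift_slice (position t + ends_below t) t'; t]
                   [:: t; shift_slice (position t + ends_above t) t'].
  move=> ct h; apply: ctx_eq_planar => //.
  - by case: t t' ct {h} => [i|i|//] [j|j|].
  - by case: t t' ct {h} => [i|i|//] [j|j|].
  - case: t t' ct h => [i|i|//] [j|j|//] _ /= h; rewrite ?addn0 in h *; ends_in h.
    + by apply: trace_eq_cup_cup; lia.
    + by apply: trace_eq_cup_cap; lia.
    + by apply: trace_eq_cap_cup; lia.
    + by apply: trace_eq_cap_cap; lia.
have half t t' m1 k1 : crossingless [:: t] ->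
    has_ends m1 k1 [:: shift_slice (position t + ends_below t) t'; t] ->
    ctx_eq 1 m1 k1 [:: shift_slice (position t + ends_below t) t'; t]
                   [:: t; shift_slice (position t + ends_above t) t'].
  move=> ct h; case: t' h => [j|j|b j] h.
  - by apply: planar; rewrite // /crossingless /= in ct *; case: (t) ct.
  - by apply: planar; rewrite // /crossingless /= in ct *; case: (t) ct.
  apply: (@ctx_eq_skein _ _ b _ _ [::] [:: t] [:: t] [::]).
    exact: ctx_eq_refl.
  apply: (@ctx_eq_trans1 _ _ [:: Cap (position t + ends_below t + j); t;
                                Cup (position t + ends_above t + j)]).
    apply: (@ctx_eq_catl 1 (m1 - 2) k1 m1 [:: Cap _]).
      by case: t ct h => [i|i|//] _ h; ends_in h; ends.
    apply: (planar t (Cup j)); first by case: (t) ct.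
    by case: t ct h => [i|i|//] _ h; ends_in h; ends.
  apply: (@ctx_eq_catr 1 m1 (k1 - 2) k1 [:: Cup _]
     [:: Cap (position t + ends_below t + j); t]
     [:: t; Cap (position t + ends_above t + j)]).
    by case: t ct h => [i|i|//] _ h; ends_in h; ends.
  apply: (planar t (Cap j)); first by case: (t) ct.
  by case: t ct h => [i|i|//] _ h; ends_in h; ends.
move=> h; case: s h => [i|i|b i] h; [exact: half|exact: half|].
apply: (@ctx_eq_skein _ _ b _ _ [:: shift_slice (i + 2) s'] [::] [::] [:: _]).
  exact: ctx_eq_refl.
apply: (@ctx_eq_trans1 _ _ [:: Cap i; shift_slice i s'; Cup i]).
  apply: (@ctx_eq_catr 1 m (k - 2) k [:: Cup i] [:: shift_slice (i + 2) s'; Cap i]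
    [:: Cap i; shift_slice i s']).
    by case: s' h => [j|j|c j] h; ends_in h; ends.
  have := @half (Cap i) s' m (k - 2)%N isT; rewrite /= addn0; apply.
  by case: s' h => [j|j|c j] h; ends_in h; ends.
apply: (@ctx_eq_catl 1 (m - 2) k m [:: Cap i]).
  by case: s' h => [j|j|c j] h; ends_in h; ends.
have := @half (Cup i) s' (m - 2)%N k isT; rewrite /= addn0; apply.
by case: s' h => [j|j|c j] h; ends_in h; ends.
Qed.

Lemma ctx_eq_zigzag_left m i : (i < m)%N -> ctx_eq 1 m m [:: Cup i; Cap i.+1] [::].
Proof.
by move=> lt_i; apply: ctx_eq_planar => //; [ends | apply: trace_eq_zigzag_left].
Qed.

Lemma ctx_eq_zigzag_right m i : (i < m)%N -> ctx_eq 1 m m [:: Cup i.+1; Cap i] [::].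
Proof.
by move=> lt_i; apply: ctx_eq_planar => //; [ends | apply: trace_eq_zigzag_right].
Qed.

(** * Moves of crossings *)

(** The four smoothings of a second Reidemeister move: [x] stands for two vertical strands, [y] for
    a maximum below a minimum, and [d] for the loop between two copies of the latter. The
    coefficient of [y] vanishes precisely by the choice of the loop value. *)
Lemma R2_coef (R : comNzRingType) (a b d x y : R) :
  a * b = 1 -> d = - a ^+ 2 - b ^+ 2 ->
  a * (b * x + a * y) + b * (b * y + a * (d * y)) = x.
Proof.
move=> ab1 ->.
have -> : a * (b * x + a * y) + b * (b * y + a * ((- a ^+ 2 - b ^+ 2) * y)) =
  (a * b) * x + (1 - a * b) * (a ^+ 2 + b ^+ 2) * y by ring.
by rewrite ab1; ring.
Qed.

Lemma ctx_eq_R2 m b i : (i + 2 <= m)%N ->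
  ctx_eq 1 m m [:: Cross b i; Cross (~~ b) i] [::].
Proof.
move=> le_i u v hu hv; rewrite mul1r (ctx_skein [::] b i [:: Cross _ i]) /=.
rewrite (ctx_skein [::] (~~ b) i [::]) (ctx_skein [:: Cap i; Cup i] (~~ b) i [::]) /=.
have -> : bracket (u ++ [:: Cap i, Cup i, Cap i, Cup i & v]) =
    delta * bracket (u ++ [:: Cap i, Cup i & v]).
  rewrite -(cat1s (Cap i)) -[[:: Cup i, Cap i, _ & v]]/([:: Cup i; Cap i] ++ _).
  rewrite catA (@ctx_eq_loop (m - 2)) -?catA //=.
  - by apply: has_ends_comp hu _; ends.
  - by rewrite -cat1s; apply: has_ends_comp hv; ends.
  - by lia.
  - by case: (u).
case: b => /=; apply: R2_coef; rewrite /delta ?[Ainv * A]mulrC ?mulAAinv //.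
by rewrite addrC.
Qed.

(** On each side one smoothing leaves the maximum and the other a zigzag that straightens to the
    maximum of the other side. The opposite crossing types make the coefficients match. *)
Lemma ctx_eq_cross_cap m b i : (i + 3 <= m)%N ->
  ctx_eq 1 m (m - 2) [:: Cross b i; Cap i.+1] [:: Cross (~~ b) i.+1; Cap i].
Proof.
move=> le_i u v hu hv; rewrite mul1r.
rewrite (ctx_skein [::] b i [:: Cap _]) (ctx_skein [::] (~~ b) i.+1 [:: Cap _]) /=.
have e1 : ctx_eq 1 m (m - 2) ([:: Cap i] ++ [:: Cup i; Cap i.+1]) ([:: Cap i] ++ [::]).
  by apply: (@ctx_eq_catl _ (m - 2)); [ends | apply: ctx_eq_zigzag_left; lia].
have e2 : ctx_eq 1 m (m - 2) ([:: Cap i.+1] ++ [:: Cup i.+1; Cap i])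
                             ([:: Cap i.+1] ++ [::]).
  by apply: (@ctx_eq_catl _ (m - 2)); [ends | apply: ctx_eq_zigzag_right; lia].
have /= -> := e1 u v hu hv; have /= -> := e2 u v hu hv.
by rewrite !mul1r; case: b; rewrite addrC.
Qed.

Lemma ctx_eq_cross_cup m b i : (i + 1 <= m)%N ->
  ctx_eq 1 m (m + 2) [:: Cup i.+1; Cross b i] [:: Cup i; Cross (~~ b) i.+1].
Proof.
move=> le_i u v hu hv; rewrite mul1r.
rewrite (ctx_skein [:: Cup _] b i [::]) (ctx_skein [:: Cup _] (~~ b) i.+1 [::]) /=.
have e1 : ctx_eq 1 m (m + 2) ([:: Cup i.+1; Cap i] ++ [:: Cup i]) ([::] ++ [:: Cup i]).
  by apply: (@ctx_eq_catr _ _ m); [ends | apply: ctx_eq_zigzag_right; lia].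
have e2 : ctx_eq 1 m (m + 2) ([:: Cup i; Cap i.+1] ++ [:: Cup i.+1])
                             ([::] ++ [:: Cup i.+1]).
  by apply: (@ctx_eq_catr _ _ m); [ends | apply: ctx_eq_zigzag_left; lia].
have /= -> := e1 u v hu hv; have /= -> := e2 u v hu hv.
by rewrite !mul1r; case: b; rewrite addrC.
Qed.

(** The factor of a curl: one smoothing removes the curl, the other splits off a loop of value
    [delta]. *)
Definition kink (b : bool) : laurent := - (if b then Ainv else A) ^+ 3.

Lemma kinkK b : kink b * kink (~~ b) = 1.
Proof.
by rewrite /kink mulrNN -exprMn; case: b; rewrite ?[Ainv * A]mulrC mulAAinv expr1n.
Qed.

Lemma kinkE b : (if b then A else Ainv) + (if b then Ainv else A) * delta = kink b.
Proof.
rewrite /kink /delta; case: b.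
  have -> : A + Ainv * (- A ^+ 2 - Ainv ^+ 2) = A * (1 - A * Ainv) - Ainv ^+ 3 by ring.
  by rewrite mulAAinv subrr mulr0 add0r.
have -> : Ainv + A * (- A ^+ 2 - Ainv ^+ 2) = Ainv * (1 - A * Ainv) - A ^+ 3 by ring.
by rewrite mulAAinv subrr mulr0 add0r.
Qed.

Lemma ctx_eq_R1_cap m b i : (i + 2 <= m)%N ->
  ctx_eq (kink b) m (m - 2) [:: Cross b i; Cap i] [:: Cap i].
Proof.
move=> le_i u v hu hv; rewrite (ctx_skein [::] b i [:: Cap _]) /=.
have -> : bracket (u ++ [:: Cap i, Cup i, Cap i & v]) = delta * bracket (u ++ Cap i :: v).
  rewrite -(cat1s (Cap i) v) -(cat1s (Cap i) (_ :: _)).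
  rewrite -[[:: Cup i, Cap i & v]]/([:: Cup i; Cap i] ++ v) !(catA u).
  rewrite (@ctx_eq_loop (m - 2)) //.
  - by apply: has_ends_comp hu _; ends.
  - by lia.
  - by case: (u).
by rewrite mulrA -mulrDl kinkE.
Qed.

Lemma ctx_eq_R1_cup m b i : (i <= m)%N ->
  ctx_eq (kink b) m (m + 2) [:: Cup i; Cross b i] [:: Cup i].
Proof.
move=> le_i u v hu hv; rewrite (ctx_skein [:: Cup _] b i [::]) /=.
have -> : bracket (u ++ [:: Cup i, Cap i, Cup i & v]) = delta * bracket (u ++ Cup i :: v).
  rewrite -[[:: Cup i, Cap i & _]]/([:: Cup i; Cap i] ++ _).
  rewrite (@ctx_eq_loop m) //.
  - by rewrite -cat1s; apply: has_ends_comp hv; ends.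
  - by case: (u).
by rewrite mulrA -mulrDl kinkE.
Qed.

(** * Naturality: exchanging diagrams and sweeping a strand *)

Lemma shift_slice_add a b s : shift_slice a (shift_slice b s) = shift_slice (a + b) s.
Proof. by case: s => [i|i|c i] /=; rewrite addnA. Qed.

Lemma shift0 w : shift 0 w = w.
Proof. by elim: w => //= s w ->; case: s. Qed.

Lemma has_ends_shift a r m k w :
  has_ends m k w -> has_ends (a + m + r) (a + k + r) (shift a w).
Proof.
elim: w m => [|s w IH] m; first by rewrite /has_ends /= => /eqP[->].
move=> /has_ends_cons[j hs /IH hw]; rewrite /= -cat1s; apply: has_ends_comp hw.
by case: s hs => [i|i|c i] hs; ends_in hs; ends.
Qed.

Lemma ctx_eq_exchange_slice s s' j k p q :
  has_ends j k [:: s] -> has_ends p q [:: s'] ->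
  ctx_eq 1 (j + p) (k + q) [:: shift_slice j s'; s] [:: s; shift_slice k s'].
Proof.
(* The number of strands of the left block to the right of the nontrivial part of [s]. *)
move=> hs hs'; set i := (j - (position s + ends_below s))%N.
have -> : shift_slice j s' =
    shift_slice (position s + ends_below s) (shift_slice i s').
  rewrite shift_slice_add; congr shift_slice.
  by case: s hs @i => [i|i|c i] hs; ends_in hs; rewrite /=; lia.
have -> : shift_slice k s' =
    shift_slice (position s + ends_above s) (shift_slice i s').
  rewrite shift_slice_add; congr shift_slice.
  by case: s hs @i => [i|i|c i] hs; ends_in hs; rewrite /=; lia.
apply: ctx_eq_commute; rewrite -cat1s; apply: (@has_ends_comp _ (j + q)).
  rewrite shift_slice_add.
  have := @has_ends_shift j 0 _ _ _ hs'; rewrite !addn0 /=; congr has_ends.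
  congr [:: shift_slice _ _].
  by case: s hs @i => [i|i|c i] hs; ends_in hs; rewrite /=; lia.
by have := @has_ends_shift 0 q _ _ _ hs; rewrite !add0n shift0.
Qed.

(** The interchange law of a monoidal category. Each slice of [t] in turn passes below the whole of
    [u]. *)
Lemma ctx_eq_exchange t u j k p q : has_ends j k t -> has_ends p q u ->
  ctx_eq 1 (j + p) (k + q) (shift j u ++ t) (t ++ shift k u).
Proof.
have slide s j1 k1 p1 q1 u1 : has_ends j1 k1 [:: s] -> has_ends p1 q1 u1 ->
    ctx_eq 1 (j1 + p1) (k1 + q1) (shift j1 u1 ++ [:: s]) (s :: shift k1 u1).
  move=> hs; elim: u1 p1 => [|s' u1 IH] p1.
    by rewrite /has_ends /= => /eqP[->]; apply: ctx_eq_refl.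
  move=> /has_ends_cons[r hs' hu].
  apply: (@ctx_eq_trans1 _ _ ([:: shift_slice j1 s'] ++ s :: shift k1 u1)).
    apply: (@ctx_eq_catl _ (j1 + r) _ _ [:: _] (shift j1 u1 ++ [:: s])); last exact: IH.
    by have := @has_ends_shift j1 0 _ _ _ hs'; rewrite !addn0.
  apply: (@ctx_eq_catr _ _ (k1 + r) _ _ [:: _; s] [:: s; _]).
    by have := @has_ends_shift k1 0 _ _ _ hu; rewrite !addn0.
  exact: ctx_eq_exchange_slice.
move=> + hu; elim: t j => [|s t IH] j.
  by rewrite /has_ends /= => /eqP[->]; rewrite cats0; apply: ctx_eq_refl.
move=> /has_ends_cons[r hs ht].
apply: (@ctx_eq_trans1 _ _ ([:: s] ++ shift r u ++ t)).
  rewrite -cat1s 2!catA; apply: ctx_eq_catr (slide _ _ _ _ _ _ hs hu).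
  by have := @has_ends_shift 0 q _ _ _ ht; rewrite !add0n shift0.
apply: (@ctx_eq_catl _ (r + p)); last exact: IH.
by have := @has_ends_shift 0 p _ _ _ hs; rewrite !add0n shift0.
Qed.

(** The strand at position [p + j] passes to position [p], over ([b = false]) or
    under the [j] strands in between. *)
Fixpoint sweep (b : bool) (p j : nat) : diagram :=
  if j is j'.+1 then Cross b (p + j') :: sweep b p j' else [::].

Lemma has_ends_sweep m b p j : (p + j < m)%N -> has_ends m m (sweep b p j).
Proof.
elim: j => [|j IH] lt_j; first by rewrite /has_ends.
by rewrite /= -cat1s; apply: (@has_ends_comp _ m); [ends | apply: IH; lia].
Qed.

(** The second crossing slides over the maximum to its other leg, where it cancels the first one. *)
Lemma ctx_eq_pass_cap m b i : (i + 3 <= m)%N ->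
  ctx_eq 1 m (m - 2) [:: Cross b i.+1; Cross b i; Cap i.+1] [:: Cap i].
Proof.
move=> le_i.
apply: (@ctx_eq_trans1 _ _ ([:: Cross b i.+1] ++ [:: Cross (~~ b) i.+1; Cap i])).
  by apply: (@ctx_eq_catl _ m _ _ [:: _] [:: _; _]); [ends | apply: ctx_eq_cross_cap].
apply: (@ctx_eq_catr _ _ m _ _ [:: _; _] [::]); first by ends.
by apply: ctx_eq_R2; lia.
Qed.

Lemma ctx_eq_pass_cup m b i : (i + 1 <= m)%N ->
  ctx_eq 1 m (m + 2) [:: Cup i.+1] [:: Cup i; Cross b i.+1; Cross b i].
Proof.
move=> le_i; apply: ctx_eq_sym.
apply: (@ctx_eq_trans1 _ _ ([:: Cup i.+1; Cross (~~ b) i] ++ [:: Cross b i])).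
  apply: (@ctx_eq_catr _ _ (m + 2) _ _ [:: _; _] [:: _; _]); first by ends.
  by apply: ctx_eq_sym; rewrite -{2}(negbK b); apply: ctx_eq_cross_cup.
apply: (@ctx_eq_catl _ (m + 2) _ _ [:: _] [:: _; _] [::]); first by ends.
by rewrite -{2}(negbK b); apply: ctx_eq_R2; lia.
Qed.

(** Smoothing the crossing of s reduces its case to those of a maximum and a
  minimum, so that the third Reidemeister move is not needed but obtained. *)
Lemma ctx_eq_sweep_slice b p r s j k : has_ends j k [:: s] ->
  ctx_eq 1 (p + j + 1 + r) (p + k + 1 + r)
    (sweep b p j ++ [:: shift_slice p.+1 s]) (shift_slice p s :: sweep b p k).
Proof.
(* Here [t] lies to the right of the whole sweep and commutes with it. *)
have far t i j1 k1 : has_ends j1 k1 [:: t] ->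
    ctx_eq 1 (p + i + 1 + j1) (p + i + 1 + k1)
      (sweep b p i ++ [:: shift_slice (p + i).+1 t])
      (shift_slice (p + i).+1 t :: sweep b p i).
  move=> ht; apply: ctx_eq_sym; rewrite -[(p + i).+1]addn1.
  have hs : has_ends (p + i + 1) (p + i + 1) (sweep b p i).
    by apply: has_ends_sweep; lia.
  exact: ctx_eq_exchange hs ht.
(* The strand meets the rightmost strand of the block first. As [t] does not touch either of them,
   that crossing can be moved above [t]. *)
have step t r1 j1 k1 : has_ends j1 k1 [:: t] ->
    ctx_eq 1 (p + j1 + 1 + r1.+1) (p + k1 + 1 + r1.+1)
      (sweep b p j1 ++ [:: shift_slice p.+1 t]) (shift_slice p t :: sweep b p k1) ->
    ctx_eq 1 (p + j1.+1 + 1 + r1) (p + k1.+1 + 1 + r1)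
      (sweep b p j1.+1 ++ [:: shift_slice p.+1 t]) (shift_slice p t :: sweep b p k1.+1).
  move=> ht IH.
  rewrite (_ : p + j1.+1 + 1 + r1 = p + j1 + 1 + r1.+1)%N; last by lia.
  rewrite (_ : p + k1.+1 + 1 + r1 = p + k1 + 1 + r1.+1)%N; last by lia.
  apply: (@ctx_eq_trans1 _ _ ([:: Cross b (p + j1)] ++ shift_slice p t :: sweep b p k1)).
    by apply: (@ctx_eq_catl _ _ _ _ [:: _] (sweep b p j1 ++ [:: _])) IH; ends.
  apply: (@ctx_eq_catr _ _ (p + k1 + 1 + r1.+1) _ _ [:: Cross _ _; _] [:: _; Cross _ _]).
    by apply: has_ends_sweep; lia.
  have hp : has_ends (p + j1) (p + k1) [:: shift_slice p t].
    by have := @has_ends_shift p 0 _ _ _ ht; rewrite !addn0.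
  have hc : has_ends (1 + r1.+1) (1 + r1.+1) [:: Cross b 0] by ends.
  by have := ctx_eq_exchange_slice hp hc; rewrite /= !addn0 !addnA.
have base_cup r1 i : ctx_eq 1 (p + i + 1 + r1) (p + (i + 2) + 1 + r1)
    (sweep b p i ++ [:: shift_slice p.+1 (Cup i)])
    (shift_slice p (Cup i) :: sweep b p (i + 2)).
  have h0 : has_ends r1 (2 + r1) [:: Cup 0] by ends.
  rewrite (_ : p + (i + 2) + 1 + r1 = p + i + 1 + (2 + r1))%N; last by lia.
  apply: ctx_eq_trans1; first by have := far _ i _ _ h0; rewrite /= addn0; apply.
  rewrite [(i + 2)%N]addn2 /= [(p + i.+1)%N]addnS.
  apply: (@ctx_eq_catr _ _ (p + i + 1 + (2 + r1)) _ _ [:: _] [:: _; _; _]).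
    by apply: has_ends_sweep; lia.
  by rewrite (_ : p + i + 1 + (2 + r1) = p + i + 1 + r1 + 2)%N; last lia;
    apply: ctx_eq_pass_cup; lia.
have base_cap r1 i : ctx_eq 1 (p + (i + 2) + 1 + r1) (p + i + 1 + r1)
    (sweep b p (i + 2) ++ [:: shift_slice p.+1 (Cap i)])
    (shift_slice p (Cap i) :: sweep b p i).
  have h0 : has_ends (2 + r1) r1 [:: Cap 0] by ends.
  rewrite (_ : p + (i + 2) + 1 + r1 = p + i + 1 + (2 + r1))%N; last by lia.
  rewrite [(i + 2)%N]addn2 /= [(p + i.+1)%N]addnS.
  apply: (@ctx_eq_trans1 _ _ ([:: Cross b (p + i).+1; Cross b (p + i)] ++
                              Cap (p + i).+1 :: sweep b p i)).
    apply: (@ctx_eq_catl _ (p + i + 1 + (2 + r1)) _ _ [:: _; _] (sweep b p i ++ [:: _])).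
      by ends.
    by have := far _ i _ _ h0; rewrite /= addn0; apply.
  apply: (@ctx_eq_catr _ _ (p + i + 1 + r1) _ _ [:: _; _; _] [:: _]).
    by apply: has_ends_sweep; lia.
  by rewrite (_ : p + i + 1 + r1 = p + i + 1 + (2 + r1) - 2)%N; last lia;
    apply: ctx_eq_pass_cap; lia.
have noncross t j1 k1 r1 : crossingless [:: t] -> has_ends j1 k1 [:: t] ->
    ctx_eq 1 (p + j1 + 1 + r1) (p + k1 + 1 + r1)
      (sweep b p j1 ++ [:: shift_slice p.+1 t]) (shift_slice p t :: sweep b p k1).
  move=> ct; elim: j1 k1 r1 => [|j1 IH] k1 r1 ht.
    case: t ct ht => [i|i|//] _ ht; ends_in ht; last by lia.
    by have [-> ->] : i = 0%N /\ k1 = 2%N by [lia]; apply: base_cup.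
  (* Either the rightmost strand of the block is free and [step] peels it off, or [t] sits at the
     right edge of the block; then the sweep beyond the turn commutes with it by [far], and the
     strand passes the turn itself. *)
  have [lt_t|ge_t] := leqP (position t + ends_below t) j1.
    case: k1 ht => [|k1] ht; first by case: t ct ht lt_t {IH} => [i|i|//] _ ht; ends_in ht; rewrite /=; lia.
    have ht' : has_ends j1 k1 [:: t].
      by case: t ct ht lt_t {IH} => [i|i|//] _ ht /= lt_t; ends_in ht; ends.
    exact: step ht' (IH _ _ ht').
  case: t ct ht ge_t {IH} => [i|i|//] _ ht; ends_in ht; rewrite /= => ge_t.
    by have [-> ->] : i = j1.+1 /\ k1 = (j1.+1 + 2)%N by [lia]; apply: base_cup.
  have [-> ->] : j1 = i.+1 /\ k1 = i by lia.
  by have := base_cap r1 i; rewrite [(i + 2)%N]addn2.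
case: s => [i|i|c i] hs; [exact: noncross|exact: noncross|].
move: hs; rewrite has_ends_cross => /andP[le_i /eqP->].
apply: (@ctx_eq_skein _ _ c _ _ (sweep b p j) [::] [::] (sweep b p j)).
  by rewrite cats0; apply: ctx_eq_refl.
apply: (@ctx_eq_trans1 _ _ ((Cap (p + i) :: sweep b p (j - 2)) ++ [:: Cup (p.+1 + i)])).
  rewrite -[[:: Cap _; Cup _]]/([:: Cap (p.+1 + i)] ++ [:: Cup (p.+1 + i)]) catA.
  apply: (@ctx_eq_catr _ _ (p + (j - 2) + 1 + r)); first by ends.
  by apply: (noncross (Cap i)) => //; ends.
apply: (@ctx_eq_catl _ (p + (j - 2) + 1 + r) _ _ [:: _] (sweep b p (j - 2) ++ [:: _])).
  by ends.
by apply: (noncross (Cup i)) => //; ends.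
Qed.

(** This is the sweep of a strand across a single crossing, with [j = k = 2]. *)
Lemma ctx_eq_R3 m b i : (i + 3 <= m)%N ->
  ctx_eq 1 m m [:: Cross b i; Cross b i.+1; Cross b i]
               [:: Cross b i.+1; Cross b i; Cross b i.+1].
Proof.
move=> le_i; have h2 : has_ends 2 2 [:: Cross b 0] by [].
have := @ctx_eq_sweep_slice b i (m - i - 3) _ _ _ h2.
rewrite (_ : i + 2 + 1 + (m - i - 3) = m)%N; last by lia.
rewrite /= !addn0 addn1.
exact: ctx_eq_sym.
Qed.

(** * Isotopy changes the bracket by a unit *)

Lemma move_ctx_eq a b m k : move a b -> has_ends m k a -> has_ends m k b ->
  exists2 g, exists h, g * h = 1 & ctx_eq g m k a b.
Proof.
have one : exists h, 1 * h = 1 :> laurent by exists 1; rewrite mul1r.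
case=> [s s'|i|i|c i|c i|c i|c i|c i|c i] ha hb.
- by exists 1 => //; apply: ctx_eq_commute.
- exists 1 => //; ends_in hb; have -> : k = m by [].
  by ends_in ha; apply: ctx_eq_zigzag_left; lia.
- exists 1 => //; ends_in hb; have -> : k = m by [].
  by ends_in ha; apply: ctx_eq_zigzag_right; lia.
- exists 1 => //; ends_in ha; have -> : k = (m - 2)%N by lia.
  by apply: ctx_eq_cross_cap; lia.
- exists 1 => //; ends_in ha; have -> : k = (m + 2)%N by lia.
  by apply: ctx_eq_cross_cup; lia.
- exists (kink c); first by exists (kink (~~ c)); apply: kinkK.
  by ends_in ha; have -> : k = (m - 2)%N by [lia]; apply: ctx_eq_R1_cap; lia.
- exists (kink c); first by exists (kink (~~ c)); apply: kinkK.
  by ends_in ha; have -> : k = (m + 2)%N by [lia]; apply: ctx_eq_R1_cup; lia.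
- exists 1 => //; ends_in hb; have -> : k = m by [].
  by ends_in ha; apply: ctx_eq_R2; lia.
- exists 1 => //; ends_in ha; have -> : k = m by lia.
  by apply: ctx_eq_R3; lia.
Qed.

Lemma isotopic_ctx_eq m k a b : isotopic m k a b ->
  exists2 g, exists h, g * h = 1 & ctx_eq g m k a b.
Proof.
elim=> [_ _ [u v c d mv huc hud]|c|c d _ [g [h gh] cd]|c d e _ [g [h gh] cd] _ [g' [h' gh'] de]].
- have [j hu /has_ends_cat[j' hc hv]] := has_ends_cat huc.
  have [i hu' /has_ends_cat[i' hd hv']] := has_ends_cat hud.
  have Ei := has_ends_fun hu' hu; rewrite {i}Ei in hd hu'.
  (* Both sides of a move change the number of strands by the same amount. *)
  have Ej : i' = j'.
    case: mv hc hd {huc hud} => [[i|i|b1 i] [l|l|b2 l]|i|i|b1 i|b1 i|b1 i|b1 i|b1 i|b1 i] hc hd;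
      ends_in hc; ends_in hd; lia.
  rewrite {}Ej in hd hv'; have [g gh cd] := move_ctx_eq mv hc hd.
  by exists g => //; apply: ctx_eq_cat cd.
- by exists 1; [exists 1; rewrite mul1r | apply: ctx_eq_refl].
- exists h; first by exists g; rewrite mulrC.
  by move=> u v hu hv; rewrite cd // mulrA [h * g]mulrC gh mul1r.
- exists (g * g'); first by exists (h * h'); rewrite mulrACA gh gh' mulr1.
  exact: ctx_eq_trans cd de.
Qed.

Lemma isotopic_ends m k a b : isotopic m k a b -> has_ends m k a = has_ends m k b.
Proof. by elim=> [_ _ [u v c d _ -> ->]|//|c d _ ->|c d e _ -> _ ->]. Qed.

(** * Bringing a tangle in a link to the bottom *)

Lemma ctx_eq_sweep b p r t j k : has_ends j k t ->
  ctx_eq 1 (p + j + 1 + r) (p + k + 1 + r)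
    (sweep b p j ++ shift p.+1 t) (shift p t ++ sweep b p k).
Proof.
elim: t j => [|s t IH] j.
  by rewrite /has_ends /= => /eqP[->]; rewrite cats0; apply: ctx_eq_refl.
move=> /has_ends_cons[i hs ht].
apply: (@ctx_eq_trans1 _ _ ((shift_slice p s :: sweep b p i) ++ shift p.+1 t)).
  rewrite [shift _ (s :: t)]/= -[shift_slice p.+1 s :: _]cat1s catA.
  apply: (@ctx_eq_catr _ _ (p + i + 1 + r)); last exact: ctx_eq_sweep_slice.
  by have := @has_ends_shift p.+1 r _ _ _ ht; congr has_ends; lia.
apply: (@ctx_eq_catl _ (p + i + 1 + r) _ _ [:: _]); last exact: IH.
by have := @has_ends_shift p (1 + r) _ _ _ hs; rewrite !addnA.
Qed.

(** As [t] has no ends at the bottom, the sweep below it is empty and all the crossings collect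
    above it, in [x]. Each swept strand joins the [r] strands on the right, hence the general
    [r]. *)
Lemma ctx_eq_pull a r t k : has_ends 0 k t ->
  exists2 x, has_ends (a + k + r) (a + k + r) x
           & ctx_eq 1 (a + r) (a + k + r) (shift a t) (t ++ x).
Proof.
move=> ht; elim: a r => [|a IH] r.
  exists [::]; first by rewrite /has_ends.
  by rewrite shift0 cats0; apply: ctx_eq_refl.
have [x hx ex] := IH r.+1.
have hs : has_ends (a + k + r.+1) (a + k + r.+1) (sweep true a k).
  by apply: has_ends_sweep; lia.
rewrite (_ : a.+1 + k + r = a + k + r.+1)%N; last by lia.
exists (x ++ sweep true a k); first exact: has_ends_comp hs.
apply: (@ctx_eq_trans1 _ _ (shift a t ++ sweep true a k)).
  rewrite (_ : a.+1 + r = a + 0 + 1 + r)%N; last by lia.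
  rewrite (_ : a + k + r.+1 = a + k + 1 + r)%N; last by lia.
  exact: (@ctx_eq_sweep true a r _ _ _ ht).
by rewrite catA addSnnS; apply: ctx_eq_catr ex.
Qed.

Lemma bracket_pull n u a t v : (0 < n)%N -> has_ends 0 n t ->
  link_diagram (u ++ shift a t ++ v) ->
  exists2 w, has_ends n 0 w & bracket (u ++ shift a t ++ v) = bracket (t ++ w).
Proof.
move=> n_gt0 ht /has_ends_cat[m hu /has_ends_cat[j hat hv]].
(* An empty [t] would not bound [a]; as [n] is positive, [t] starts with a minimum, which needs [a]
   strands on its left. *)
have le_a : (a <= m)%N.
  case: t ht hat => [|s t]; first by rewrite /has_ends /= => /eqP[n0]; rewrite -n0 in n_gt0.
  move=> /has_ends_cons[i hs _] /has_ends_cons[i' hs' _].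
  by case: s hs hs' => [l|l|c l] hs hs'; ends_in hs; ends_in hs'; lia.
have Ej : (a + n + (m - a))%N = j.
  have := @has_ends_shift a (m - a) _ _ _ ht; rewrite addn0 subnKC // => h.
  exact: has_ends_fun h hat.
have [x] := @ctx_eq_pull a (m - a) t n ht; rewrite Ej subnKC // => hx ex.
have hxv := has_ends_comp hx hv.
rewrite ex // mul1r -catA catA.
have := ctx_eq_exchange ht hu; rewrite shift0 => /(_ [::] (x ++ v)) /= -> //; last first.
  by rewrite (_ : n + m = j)%N //; lia.
rewrite mul1r -catA; eexists; last by [].
apply: has_ends_comp hxv; rewrite -Ej.
have := @has_ends_shift n 0 _ _ _ hu; rewrite !addn0; congr has_ends; lia.
Qed.

(** * Expansion over Catalan tangles *)

Definition caps_only (q : diagram) : bool :=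
  all (fun s => if s is Cap _ then true else false) q.

Lemma cup_caps q m i x : caps_only q -> has_ends (m + 2) 0 q -> (i <= m)%N ->
  has_ends 0 m x -> x <> [::] ->
  exists d q', [/\ caps_only q', has_ends m 0 q'
                 & bracket (x ++ Cup i :: q) = d * bracket (x ++ q')].
Proof.
elim: q m i x => [|[j|j|//] q IH] m i x //=; first by rewrite /has_ends => _ /eqP[]; lia.
move=> cq /has_ends_cons[k]; rewrite has_ends_cap => /andP[le_j /eqP Ek] hq le_i hx ne.
have Ekm : k = m by lia.
rewrite {}Ekm {Ek} in hq.
have far i' j' : (i' + 2 <= m)%N -> (j' + 2 <= m)%N ->
    ctx_eq 1 m m [:: Cup i; Cap j] [:: Cap j'; Cup i'] ->
    exists d q', [/\ caps_only q', has_ends m 0 q'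
                   & bracket (x ++ [:: Cup i, Cap j & q]) = d * bracket (x ++ q')].
  move=> le_i' le_j' com.
  have hc : has_ends m (m - 2) [:: Cap j'] by ends.
  have hq2 : has_ends (m - 2 + 2) 0 q by rewrite subnK //; lia.
  have le_i2 : (i' <= m - 2)%N by lia.
  have ne2 : x ++ [:: Cap j'] <> [::] by case: (x).
  have [d [q' [cq' hq' Eq]]] := IH _ _ _ cq hq2 le_i2 (has_ends_comp hx hc) ne2.
  exists d, (Cap j' :: q'); split=> //; first exact: has_ends_comp hc hq'.
  by have /= -> := com x q hx hq; rewrite mul1r -cat_rcons -cats1 Eq -catA.
have [lt_ij|lt_ji|E] := ltngtP i j.
- have [E|lt_ij2] : j = i.+1 \/ (i.+1 < j)%N by lia.
    exists 1, q; split=> //; rewrite E.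
    by apply: (ctx_eq_zigzag_left _ hx hq); lia.
  apply: (far i (j - 2)%N); [lia|lia|].
  apply: ctx_eq_sym; have := @ctx_eq_commute (Cup i) (Cap (j - i - 2)) m m.
  rewrite /= addn0 (_ : i + (j - i - 2) = j - 2)%N; last by lia.
  by rewrite (_ : i + 2 + (j - i - 2) = j)%N; last lia; apply; ends.
- have [E|lt_ji2] : i = j.+1 \/ (j.+1 < i)%N by lia.
    exists 1, q; split=> //; rewrite E.
    by apply: (ctx_eq_zigzag_right _ hx hq); lia.
  apply: (far (i - 2)%N j); [lia|lia|].
  have := @ctx_eq_commute (Cap j) (Cup (i - j - 2)) m m.
  rewrite /= addn0 (_ : j + (i - j - 2) = i - 2)%N; last by lia.
  by rewrite (_ : j + 2 + (i - j - 2) = i)%N; last lia; apply; ends.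
- exists delta, q; split=> //; rewrite -E.
  by apply: (ctx_eq_loop hx hq); first lia; case: (x) ne.
Qed.

Lemma ideal_generated_gen (R : comNzRingType) (S : R -> Prop) x :
  S x -> ideal_generated S x.
Proof.
move=> Sx; exists [:: (1, x)]; last by rewrite big_seq1 mul1r.
by move=> p; rewrite inE => /eqP->.
Qed.

Lemma ideal_generatedD (R : comNzRingType) (S : R -> Prop) x y :
  ideal_generated S x -> ideal_generated S y -> ideal_generated S (x + y).
Proof.
move=> [s hs ->] [t ht ->]; exists (s ++ t); last by rewrite big_cat.
by move=> p; rewrite mem_cat => /orP[/hs|/ht].
Qed.

Lemma ideal_generatedZ (R : comNzRingType) (S : R -> Prop) a x :
  ideal_generated S x -> ideal_generated S (a * x).
Proof.
move=> [s hs ->]; exists [seq (a * p.1, p.2) | p <- s].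
  by move=> _ /mapP[p /hs Sp ->].
by rewrite big_map mulr_sumr; apply: eq_bigr => p _; rewrite mulrA.
Qed.

(** The slices of [w] move into [x] one by one, and the hypothesis on maxima has to be restored for
    each longer [x]: a maximum is put in front of [q], a minimum is absorbed by [cup_caps], and a
    crossing is smoothed into these. *)
Lemma bracket_caps_span (S : laurent -> Prop) w m x :
  has_ends m 0 w -> has_ends 0 m x -> x <> [::] ->
  (forall q, caps_only q -> has_ends m 0 q -> ideal_generated S (bracket (x ++ q))) ->
  ideal_generated S (bracket (x ++ w)).
Proof.
elim: w m x => [|s w IH] m x; first by move=> hw _ _; apply.
have ne_cat u : x <> [::] -> x ++ u <> [::] by case: (x).
move=> /has_ends_cons[k hs hw] hx ne span.
have span_cup i y l : has_ends 0 l y -> y <> [::] -> (i <= l)%N ->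
    (forall q, caps_only q -> has_ends l 0 q -> ideal_generated S (bracket (y ++ q))) ->
    forall q, caps_only q -> has_ends (l + 2) 0 q ->
    ideal_generated S (bracket ((y ++ [:: Cup i]) ++ q)).
  move=> hy ney le_i spany q cq hq; rewrite -catA.
  have [d [q' [cq' hq' ->]]] := cup_caps cq hq le_i hy ney.
  exact/ideal_generatedZ/spany.
have span_cap i : has_ends m (m - 2) [:: Cap i] -> forall q, caps_only q ->
    has_ends (m - 2) 0 q -> ideal_generated S (bracket ((x ++ [:: Cap i]) ++ q)).
  by move=> hc q cq hq; rewrite -catA; apply: span => //; apply: has_ends_comp hc hq.
case: s hs => [i|i|b i] hs.
- move: hs hw; rewrite has_ends_cup => /andP[le_i /eqP->] hw.
  rewrite -cat1s catA; apply: (IH _ _ hw); [|exact: ne_cat|exact: span_cup].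
  by apply: has_ends_comp hx _; ends.
- rewrite -cat1s catA; apply: (IH _ _ hw); [exact: has_ends_comp hx hs|exact: ne_cat|].
  move: (hs); rewrite has_ends_cap => /andP[_ /eqP Em].
  by rewrite (_ : k = m - 2)%N in hs *; [apply: span_cap|lia].
move: hs hw; rewrite has_ends_cross => /andP[le_i /eqP->] hw.
rewrite bracket_skein; apply: ideal_generatedD; apply: ideal_generatedZ.
  exact: IH hw hx ne span.
have hc : has_ends m (m - 2) [:: Cap i] by ends.
have hxc := has_ends_comp hx hc.
rewrite -[[:: Cap i, Cup i & w]]/([:: Cap i] ++ [:: Cup i] ++ w) !catA.
rewrite (_ : m = m - 2 + 2)%N in hw; last by lia.
apply: (IH _ _ hw).
- by apply: has_ends_comp hxc _; ends.
- by rewrite -catA; apply: ne_cat.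
- by apply: span_cup; [|exact: ne_cat|lia|exact: span_cap].
Qed.

Lemma flip_caps n q : caps_only q -> has_ends n.*2 0 q ->
  catalan n (flip q) /\ flip (flip q) = q.
Proof.
have flip_cons s w : flip (s :: w) = flip w ++ [:: flip_slice s].
  by rewrite /flip map_cons rev_cons cats1.
move=> cq hq; split; last first.
  by rewrite /flip map_rev revK (@mapK _ _ flip_slice) // => -[].
apply/and3P; split.
- rewrite /tangle_diagram; elim: q n.*2 cq hq => [|[i|i|//] q IH] m cq.
  + by rewrite /has_ends eq_sym.
  + by [].
  + move=> /has_ends_cons[k]; rewrite has_ends_cap => /andP[le_i /eqP Ek] hq.
    rewrite flip_cons; apply: (has_ends_comp (IH _ cq hq)).
    by rewrite has_ends_cup; lia.
- by elim: q cq {hq} => [|[i|i|//] q IH] // cq; rewrite flip_cons crossingless_cat IH.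
(* The flipped diagram has only minima, which never close a component. *)
- rewrite /closed_components; elim: q cq {hq} => [|[i|i|//] q IH] // cq.
  by rewrite flip_cons foldl_cat; case: (foldl _ _ (flip q)) (IH cq).
Qed.

Theorem theorem5p1 (n : nat) (t l : diagram) :
  (1 <= n)%N -> tangle_diagram n t -> link_diagram l ->
  embeds n t l -> tangle_ideal n t (bracket l).
Proof.
move=> n_gt0 ht hl [t' [l' [tt' [hl' [u [v [a El']]]] l'l]]].
have ht' : has_ends 0 n.*2 t' by rewrite -(isotopic_ends tt').
have [g [h gh] eql] := isotopic_ctx_eq l'l.
have -> : bracket l = h * bracket l'.
  have := eql [::] [::] isT isT; rewrite /= !cats0 => ->.
  by rewrite mulrA [h * g]mulrC gh mul1r.
apply: ideal_generatedZ; rewrite El' in hl' *.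
have n2_gt0 : (0 < n.*2)%N by rewrite double_gt0.
have [w hw ->] := bracket_pull n2_gt0 ht' hl'.
apply: (bracket_caps_span hw ht').
  by move=> E; move: ht'; rewrite E /has_ends /= => /eqP[]; lia.
(* The isotopy from [t] to [t'] fixes the ends, so [q] can be attached to both; this turns the
   generators for [t'] into those for [t]. *)
move=> q cq hq; have [g' [h' gh'] eqt] := isotopic_ctx_eq tt'.
have [cat_q flipK] := flip_caps cq hq.
have -> : bracket (t' ++ q) = h' * bracket (join t (flip q)).
  have /= := eqt [::] q isT hq; rewrite /join flipK => ->.
  by rewrite mulrA [h' * g']mulrC gh' mul1r.
by apply/ideal_generatedZ/ideal_generated_gen; exists (flip q).
Qed.
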